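(* Let $d\mu(x)=e^{-V(x)}dx$ be a probability measure on $\mathbb R^d$. Assume that there exist $K\ge0$, $\varepsilon>0$, $\alpha>2$ and $x_0\in\mathbb R^d$ such that $$D^2V(x)\ge -K\,\mathrm{Id}\quad(x\in\mathbb R^d)\qquad\text{and}\qquad\int_{\mathbb R^d}e^{\varepsilon|x-x_0|^\alpha}d\mu(x)<+\infty.$$ Then there exists $\kappa>0$ such that the isoperimetric profile of $\mu$ satisfies $$\mathcal I_\mu(t)\ge\kappa\min(t,1-t)\log^{1-\frac1\alpha}\left(\frac1{\min(t,1-t)}\right),\qquad t\in(0,1).$$
   Context: $V$ is twice differentiable with Hessian $D^2V$. For a Borel set $A$, $\mu^+(\partial A)=\liminf_{h\to0^+}\frac1h\mu(\{x\in\mathbb R^d\setminus A:\ \mathrm{dist}(x,A)\le h\})$, and $\mathcal I_\mu(t)=\inf\{\mu^+(\partial A):\ \mu(A)=t\}$ for $t\in(0,1)$. *)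

(* Defs.v *)
From HB Require Import structures.
From mathcomp Require Import all_boot all_order all_algebra.
From mathcomp Require Import all_classical all_reals all_analysis.
From mathcomp Require Import measurable_realfun.

Set Implicit Arguments.
Unset Strict Implicit.
Unset Printing Implicit Defensive.

Import Order.TTheory GRing.Theory Num.Theory.
Import numFieldNormedType.Exports.

Local Open Scope classical_set_scope.
Local Open Scope ring_scope.

(* The library puts no sigma-algebra on matrices: use the Borel one. *)
HB.instance Definition _ (R : realType) (d : nat) :=
  @isMeasurable.Build (sigma_display (@open 'rV[R]_d)) 'rV[R]_d
    <<s (@open 'rV[R]_d) >>
    (@sigma_algebra0 _ setT _) (@sigma_algebraC _ _)
    (@sigma_algebra_bigcup _ setT _).

Section borel_row.
Variable R : realType.

Lemma row_borelE (d : nat) :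
  @measurable _ 'rV[R]_d = <<s (@open 'rV[R]_d) >>.
Proof. by []. Qed.

Lemma open_measurable_row (d : nat) (U : set 'rV[R]_d) :
  open U -> measurable U.
Proof. by move=> oU; rewrite row_borelE; exact: sub_sigma_algebra. Qed.

Definition cons_row (d : nat) (z : measurableTypeR R * 'rV[R]_d) :
  'rV[R]_d.+1 := \row_i if unlift 0 i is Some j then z.2 0 j else z.1.

Definition tail_row (d : nat) (v : 'rV[R]_d.+1) : 'rV[R]_d :=
  \row_j v 0 (lift 0 j).

Lemma cons_row0 (d : nat) (z : measurableTypeR R * 'rV[R]_d) :
  cons_row z 0 0 = z.1.
Proof. by rewrite mxE unlift_none. Qed.

Lemma cons_row_lift (d : nat) (z : measurableTypeR R * 'rV[R]_d) j :
  cons_row z 0 (lift 0 j) = z.2 0 j.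
Proof. by rewrite mxE liftK. Qed.

Lemma tail_cons_row (d : nat) (z : measurableTypeR R * 'rV[R]_d) :
  tail_row (cons_row z) = z.2.
Proof. by apply/rowP => j; rewrite mxE cons_row_lift. Qed.

Lemma ball_rowP (d : nat) (v w : 'rV[R]_d) (e : R) : 0 < e ->
  ball v e w <-> forall i, ball (v 0 i) e (w 0 i).
Proof.
move=> e0; rewrite /ball /= /mx_ball /=; split.
  by move=> [_ +] i; apply.
by move=> h; split => // i j; rewrite (ord1 i); exact: h.
Qed.

Lemma ball_cons_row (d : nat) (v : 'rV[R]_d.+1) (e : R) : 0 < e ->
  @cons_row d @^-1` ball v e = ball (v 0 0) e `*` ball (tail_row v) e.
Proof.
move=> e0; apply/seteqP; split => z /=.
  move=> /(ball_rowP _ _ e0) h; split => /=.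
    by move: (h 0); rewrite cons_row0.
  apply/(ball_rowP _ _ e0) => i.
  by move: (h (lift 0 i)); rewrite cons_row_lift mxE.
move=> [/= h0 /(ball_rowP _ _ e0) h]; apply/(ball_rowP _ _ e0) => i.
case: (unliftP 0 i) => [j ->|->]; last by rewrite cons_row0.
by rewrite cons_row_lift; move: (h j); rewrite mxE.
Qed.

Lemma open_row_bigcup (d : nat) (U : set 'rV[R]_d) : open U ->
  U = \bigcup_(p in [set p : 'rV[rat]_d * nat |
         ball (map_mx ratr p.1 : 'rV[R]_d) (p.2.+1%:R^-1) `<=` U])
        ball (map_mx ratr p.1 : 'rV[R]_d) (p.2.+1%:R^-1).
Proof.
move=> oU; apply/seteqP; split; last by move=> x [p pU] /pU.
move=> x Ux; move: oU; rewrite openE => /(_ _ Ux).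
rewrite /interior -nbhs_ballE => -[e /= e0 eU].
pose n := Num.truncn (2 / e).
have ne : n.+1%:R^-1 < e / 2 :> R.
  rewrite invf_plt ?posrE ?divr_gt0 //.
  by rewrite invf_div; exact: truncnS_gt.
have n0 : 0 < n.+1%:R^-1 :> R by rewrite invr_gt0.
have q_ (i : 'I_d) : {q : rat | `|ratr q - x 0 i| < n.+1%:R^-1}.
  have lt_itv : x 0 i - n.+1%:R^-1 < x 0 i + n.+1%:R^-1.
    by rewrite ltrD2l gtrN.
  apply: cid; have [q qi] := rat_in_itvoo lt_itv.
  by exists q; rewrite ltr_distl; move: qi; rewrite in_itv.
pose q := \row_i sval (q_ i).
have xq : ball (map_mx ratr q : 'rV[R]_d) n.+1%:R^-1 x.
  apply/(ball_rowP _ _ n0) => i; rewrite !mxE.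
  by rewrite /ball /=; exact: (svalP (q_ i)).
exists (q, n) => //= y qy; apply: eU.
rewrite (splitr e); apply: (@ball_triangle _ _ (map_mx ratr q : 'rV[R]_d)).
  by apply: (le_ball (ltW ne)); exact: ball_sym.
by apply: (le_ball (ltW ne)).
Qed.

Lemma measurable_cons_row (d : nat) : measurable_fun setT (@cons_row d).
Proof.
apply: (@measurability _ _ _ _ _ _ (@open 'rV[R]_d.+1)) => //.
move=> _ [U oU <-]; rewrite setTI (open_row_bigcup oU) preimage_bigcup.
rewrite bigcup_mkcond; apply: countable_bigcupT_measurable => [|p].
  exact: countableP.
case: ifPn => // _; rewrite ball_cons_row ?invr_gt0 //.
apply: measurableX.
  by apply: open_measurable; apply: ball_open; rewrite invr_gt0.
by apply: open_measurable_row; apply: ball_open; rewrite invr_gt0.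
Qed.

Lemma measurable_head_row (d : nat) :
  measurable_fun setT (fun v : 'rV[R]_d.+1 => v 0 0 : measurableTypeR R).
Proof.
apply: (measurability _ (RGenOpens.measurableE R)).
move=> _ [_ [a [b ->] <-]]; rewrite setTI; apply: open_measurable_row.
have /continuousP := @coord_continuous R 1 d.+1 0 0; apply.
exact: interval_open.
Qed.

Lemma measurable_tail_row (d : nat) : measurable_fun setT (@tail_row d).
Proof.
apply: (@measurability _ _ _ _ _ _ (@open 'rV[R]_d)) => //.
move=> _ [U oU <-]; rewrite setTI; apply: open_measurable_row.
have : continuous (@tail_row d); last by move=> /continuousP; apply.
move=> v A /nbhs_ballP[e /= e0 eA].
apply/nbhs_ballP; exists e => //= w /(ball_rowP _ _ e0) vw; apply: eA.
by apply/(ball_rowP _ _ e0) => i; rewrite !mxE; exact: vw.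
Qed.

End borel_row.

Section lebesgue_row.
Variable R : realType.

Definition lebesgue_succ (d : nat)
    (m : {sigma_finite_measure set 'rV[R]_d -> \bar R}) :
    set 'rV[R]_d.+1 -> \bar R :=
  pushforward (lebesgue_measure \x m)%E (@cons_row R d).

Section lebesgue_succ.
Variables (d : nat) (m : {sigma_finite_measure set 'rV[R]_d -> \bar R}).

Let mcons := @measurable_cons_row R d.

Let lebesgue_succ0 : lebesgue_succ m set0 = 0%E.
Proof. exact: measure0. Qed.

Let lebesgue_succ_ge0 A : (0 <= lebesgue_succ m A)%E.
Proof. exact: measure_ge0. Qed.

Let lebesgue_succ_additive : semi_sigma_additive (lebesgue_succ m).
Proof. exact: measure_semi_sigma_additive. Qed.

HB.instance Definition _ := isMeasure.Build _ _ _ (lebesgue_succ m)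
  lebesgue_succ0 lebesgue_succ_ge0 lebesgue_succ_additive.

Let sigma_finite_lebesgue_succ : sigma_finite setT (lebesgue_succ m).
Proof.
have /sigma_finiteP[F [TF ndF Foo]] := sigma_finiteT (@lebesgue_measure R).
have /sigma_finiteP[G [TG ndG Goo]] := sigma_finiteT m.
exists (fun n => [set v : 'rV[R]_d.+1 | F n (v 0 0) /\ G n (tail_row v)]).
  apply/seteqP; split=> // v _.
  have [i _ Fi] : (\bigcup_n F n) (v 0 0) by rewrite -TF.
  have [j _ Gj] : (\bigcup_n G n) (tail_row v) by rewrite -TG.
  exists (maxn i j) => //; split.
    by move: (v 0 0) Fi; exact/subsetPset/ndF/leq_maxl.
  by move: (tail_row v) Gj; exact/subsetPset/ndG/leq_maxr.
move=> n; have [mF Fn] := Foo n; have [mG Gn] := Goo n; split.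
  apply: measurableI; rewrite -[X in measurable X]setTI.
    exact: measurable_head_row.
  exact: measurable_tail_row.
rewrite /lebesgue_succ /pushforward.
rewrite (_ : _ @^-1` _ = F n `*` G n).
  by rewrite product_measure1E// lte_mul_pinfty// ge0_fin_numE.
by apply/seteqP; split => z /=; rewrite cons_row0 tail_cons_row.
Qed.

HB.instance Definition _ := Measure_isSigmaFinite.Build _ _ _
  (lebesgue_succ m) sigma_finite_lebesgue_succ.

End lebesgue_succ.

(* R^0 is a point, and R^(d+1) is R * R^d via cons_row. *)
Fixpoint lebesgue_row (d : nat) :
    {sigma_finite_measure set 'rV[R]_d -> \bar R} :=
  match d with
  | 0%N => dirac (0 : 'rV[R]_0)
  | d'.+1 => lebesgue_succ (lebesgue_row d')
  end.

End lebesgue_row.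

Section calculus.
Variables (R : realType) (d : nat).
Implicit Types (V : 'rV[R]_d -> R) (x u v : 'rV[R]_d) (A : set 'rV[R]_d).

(* The library norm on 'rV[R]_d is the sup norm. *)
Definition enorm x : R := Num.sqrt (\sum_(i < d) x 0 i ^+ 2).

Definition gradient V x : 'rV[R]_d := \row_j 'D_(delta_mx 0 j) V x.

(* Entry (i, j) is the i-th partial derivative of the j-th one; 'J f x acts on
   row vectors from the right. *)
Definition hessian V x : 'M[R]_d := 'J (gradient V) x.

Definition twice_differentiable V : Prop :=
  (forall x, differentiable V x) /\ (forall x, differentiable (gradient V) x).

(* Symmetry is not required; only the quadratic forms are compared. *)
Definition loewner_le (M N : 'M[R]_d) : Prop :=
  forall u, 0 <= (u *m (N - M) *m u^T) 0 0.

(* The distance to the empty set is +oo. *)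
Definition set_dist x A : \bar R := ereal_inf [set (enorm (x - a))%:E | a in A].

End calculus.

Section isoperimetry.
Variables (R : realType) (d : nat) (mu : set 'rV[R]_d -> \bar R).
Local Open Scope ereal_scope.

Definition boundary_measure (A : set 'rV[R]_d) : \bar R :=
  limf_einf (fun h : R =>
    (h^-1)%:E * mu [set x | ~ A x /\ set_dist x A <= h%:E]) 0^'+.

Definition isoperimetric_profile (t : R) : \bar R :=
  ereal_inf [set boundary_measure A | A in
    [set A | measurable A /\ mu A = t%:E]].

End isoperimetry.

(* Main.v *)
Require Import Defs.
From HB Require Import structures.
From mathcomp Require Import all_boot all_order all_algebra.
From mathcomp Require Import all_classical all_reals all_analysis.
From mathcomp Require Import measurable_realfun.
From mathcomp Require Import ring lra.

Set Implicit Arguments.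
Unset Strict Implicit.
Unset Printing Implicit Defensive.

Import Order.TTheory GRing.Theory Num.Theory.
Import numFieldNormedType.Exports.

Local Open Scope classical_set_scope.
Local Open Scope ring_scope.

(** The inequality follows from an elementary transport argument. Fix a point
    [z] and push every point [x] of a set [E] along the segment from [x] to [z],
    by a fraction [s] of it. The points of [E] that end up outside [E] must
    cross the boundary of [E] on their way. If the density of [mu] does not drop
    by more than a bounded factor along these paths, whose lengths are at most
    of order [s * r] in a ball of radius [r], then the measure of these points
    is at most a constant times [s * r] times the boundary measure of [E]
    ([crossing_le], [crossing_rate]). The lower bound on the Hessian enters
    through the resulting semiconvexity of [V] on segments ([semiconvex]), which
    controls the density along each path up to errors of order [s * r ^ 2].

    For a small set, of measure [e ^ (- L)], take [s] of order [1 / L] and [r]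
    of order [L ^ (1 / alpha)]; by the exponential moment at most a quarter of
    [E] is lost outside the ball of radius [r], and [s * r ^ 2] tends to 0 because
    [alpha > 2]. A definite part of [E] is carried outside [E] for some [z] in
    the unit ball ([tail_flux]): where [V] exceeds [L / 2] the contraction
    multiplies mass, and where it does not, the corresponding part of [E] has
    such a small volume that a random [z] sends [x] outside it. Dividing by
    [s * r] gives the rate [L ^ (1 - 1 / alpha)] ([small_set_bound]).

    For a set whose measure is away from 0 and 1, it is enough to bound the
    boundary measure below by a positive constant. This is done by joining
    points of the set to points of its complement in a large ball, through their
    midpoints ([midpoint_flux], [mid_set_bound]).

    All estimates are for the symmetric notion [separates], so that the outer
    layer of a set controls the flux out of its complement as well; this treats
    sets of measure close to 1. *)

(** * Borel measurability on row vectors *)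

Lemma measurable_preimage d1 d2 (T1 : measurableType d1)
    (T2 : measurableType d2) (f : T1 -> T2) (A : set T2) :
  measurable_fun setT f -> measurable A -> measurable (f @^-1` A).
Proof. by move=> mf mA; rewrite -[X in measurable X]setTI; exact: mf. Qed.

Section row_measurability.
Context d (T : measurableType d) (R : realType).

Lemma measurable_ball_row (n : nat) (v : 'rV[R]_n) e : measurable (ball v e).
Proof.
have [e0|e0] := ltP 0 e; first by apply: open_measurable_row; exact: ball_open.
rewrite (_ : ball v e = set0); first exact: measurable0.
apply/seteqP; split => // w [+ _]; by rewrite ltNge e0.
Qed.

Lemma measurable_coord (n : nat) (i : 'I_n) :
  measurable_fun setT (fun v : 'rV[R]_n => v 0 i : measurableTypeR R).
Proof.
apply: (measurability _ (RGenOpens.measurableE R)).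
move=> _ [_ [a [b ->] <-]]; rewrite setTI; apply: open_measurable_row.
have /continuousP := @coord_continuous R 1 n 0 i; apply.
exact: interval_open.
Qed.

(** Sup-norm balls with rational data form a countable base of the topology,
    and such a ball is a finite intersection of conditions on coordinates. *)
Lemma measurable_fun_row (n : nat) (f : T -> 'rV[R]_n) :
  (forall i, measurable_fun setT (fun x => f x 0 i : measurableTypeR R)) ->
  measurable_fun setT f.
Proof.
move=> mf; apply: (@measurability _ _ _ _ _ _ (@open 'rV[R]_n)) => //.
move=> _ [U oU <-]; rewrite setTI (open_row_bigcup oU) preimage_bigcup.
rewrite bigcup_mkcond; apply: countable_bigcupT_measurable => [|p].
  exact: countableP.
case: ifPn => // _; set v := map_mx _ _; set e := _^-1.
have e0 : 0 < e by rewrite invr_gt0.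
rewrite (_ : _ @^-1` _ =
    \bigcap_(i in [set: 'I_n]) ((fun x => f x 0 i) @^-1` ball (v 0 i) e)).
  apply: fin_bigcap_measurable => [|i _]; first exact: finite_finset.
  rewrite -[X in measurable X]setTI.
  by apply: mf => //; exact: measurable_ball.
apply/seteqP; split => x /=.
  by move=> /(ball_rowP _ _ e0) h i _; exact: h.
by move=> h; apply/(ball_rowP _ _ e0) => i; exact: h.
Qed.

Lemma continuous_measurable_row (n : nat) (f : 'rV[R]_n -> R) :
  continuous f -> measurable_fun setT (f : _ -> measurableTypeR R).
Proof.
move=> cf; apply: (measurability _ (RGenOpens.measurableE R)).
move=> _ [_ [a [b ->] <-]]; rewrite setTI; apply: open_measurable_row.
by move/continuousP : cf; apply; exact: interval_open.
Qed.

End row_measurability.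

(** * Lebesgue measure under affine contractions *)

Section lebesgue_affine.
Variable R : realType.
Local Open Scope ereal_scope.

Lemma measurable_affine_row (n : nat) (a : R) (b : 'rV[R]_n) :
  measurable_fun setT (fun v : 'rV[R]_n => a *: v + b)%R.
Proof.
apply: measurable_fun_row => i.
under eq_fun do rewrite !mxE.
apply: measurable_funD => //; apply: measurable_funM => //.
exact: measurable_coord.
Qed.

Lemma measurable_affine (a b : R) :
  measurable_fun setT (fun x => a * x + b : measurableTypeR R)%R.
Proof. by apply: measurable_funD => //; apply: measurable_funM. Qed.

Lemma lebesgue_affine (a b : R) (A : set (measurableTypeR R)) :
  (0 < a)%R -> measurable A ->
  lebesgue_measure ((fun x => a * x + b : measurableTypeR R)%R @^-1` A) =
  a^-1%:E * lebesgue_measure A.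
Proof.
move=> a0 mA.
have an0 : a != 0%R by rewrite gt_eqF.
have ma := measurable_affine a b.
pose m : {measure set (measurableTypeR R) -> \bar R} :=
  mscale (NngNum (ltW a0)) (pushforward lebesgue_measure
    (fun x => a * x + b : measurableTypeR R)%R).
have -> : lebesgue_measure A = m ma A.
  apply: lebesgue_measure_unique => // _ [[u v]] _ <-.
  rewrite /m /= /mscale /= /pushforward.
  rewrite (_ : _ @^-1` _ = `](u - b) / a, (v - b) / a]%classic)%R; last first.
    apply/seteqP; split => x /=; rewrite !in_itv/=;
    by rewrite ltr_pdivrMr// ler_pdivlMr// ltrBlDr lerBrDr mulrC.
  rewrite !lebesgue_measure_itv/= !lte_fin ltr_pM2r ?invr_gt0// ltrD2r.
  case: ifPn => _; last by rewrite mule0.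
  by rewrite -EFinM -mulrBl opprB addrA subrK mulrC divfK.
rewrite /m /= /mscale /= /pushforward muleA -EFinM mulVf// mul1e//.
Qed.
End lebesgue_affine.

Section lebesgue_row_affine.
Variable R : realType.
Local Open Scope ereal_scope.

(** By induction on the dimension: both sides agree on rectangles, by the
    one-dimensional case and the induction hypothesis, and a product measure is
    determined by its values on rectangles. *)
Lemma lebesgue_row_affine (n : nat) (a : R) (b : 'rV[R]_n) (A : set 'rV[R]_n) :
  (0 < a)%R -> measurable A ->
  lebesgue_row R n ((fun v => a *: v + b)%R @^-1` A) =
  ((a ^+ n)^-1)%:E * lebesgue_row R n A.
Proof.
move=> a0; elim: n b A => [|n IH] b A mA.
  rewrite expr0 invr1 mul1e; congr (lebesgue_row R 0 _).
  by apply/seteqP; split=> v /=; rewrite [(a *: v + b)%R]thinmx0 [v]thinmx0.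
have an0 : (a ^+ n.+1 != 0)%R by rewrite expf_neq0// gt_eqF.
pose m := lebesgue_row R n.
pose T := (measurableTypeR R * 'rV[R]_n)%type.
pose phi (z : T) : T := (a * z.1 + b 0%R 0%R, a *: z.2 + tail_row b)%R.
have mphi : measurable_fun setT phi.
  apply/measurable_fun_pairP; split.
    exact: (measurableT_comp (measurable_affine a (b 0 0)%R) measurable_fst).
  exact: (measurableT_comp (measurable_affine_row a _) measurable_snd).
have cphi z : (a *: cons_row z + b)%R = cons_row (phi z).
  apply/rowP => i; rewrite !mxE; case: (unliftP 0%R i) => [j ->|->] /=.
    by rewrite !mxE.
  by [].
have an'0 : (0 <= a ^+ n.+1)%R by rewrite exprn_ge0// ltW.
pose m' : {measure set T -> \bar R} :=
  mscale (NngNum an'0) (pushforward (lebesgue_measure \x m) phi).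
have mcons := @measurable_cons_row R n.
have mA' : measurable (@cons_row R n @^-1` A).
  by rewrite -[X in measurable X]setTI; exact: mcons.
have rectE : forall B C, measurable B -> measurable C ->
    m' mphi (B `*` C) = lebesgue_measure B * m C.
  move=> B C mB mC; rewrite /m' /= /mscale /= /pushforward.
  rewrite (_ : phi @^-1` _ =
    ((fun x : measurableTypeR R => a * x + b 0 0)%R @^-1` B) `*`
    ((fun v => a *: v + tail_row b)%R @^-1` C)); last by apply/seteqP; split.
  rewrite product_measure1E//; last 2 first.
  - rewrite -[X in measurable X]setTI; exact: (@measurable_affine R a (b 0%R 0%R)).
  - rewrite -[X in measurable X]setTI; exact: (measurable_affine_row a (tail_row b)).
  rewrite [X in _ * (X * _)](lebesgue_affine (b 0%R 0%R) a0 mB).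
  rewrite [X in _ * (_ * X)](IH (tail_row b) C mC) -/m muleACA [LHS]muleA.
  rewrite [X in X * _](_ : _ = 1) ?mul1e//.
  by rewrite -[X in _ * X]EFinM -invfM -exprS -[LHS]EFinM divff.
have := product_measure_unique rectE mA'.
rewrite /m' /= /mscale /= /pushforward => E.
rewrite /lebesgue_succ /pushforward -/m E muleA -EFinM mulVf// mul1e.
by congr ((_ \x _) _); apply/seteqP; split=> z /=; rewrite cphi.
Qed.

Lemma lebesgue_row_ball (n : nat) (v : 'rV[R]_n) (r : R) : (0 < r)%R ->
  lebesgue_row R n (ball v r) = ((r *+ 2) ^+ n)%:E.
Proof.
move=> r0; elim: n v => [|n IH] v.
  rewrite expr0 /= diracE mem_set//; split => // i [].
  by case.
rewrite /= /lebesgue_succ /pushforward ball_cons_row// product_measure1E//.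
- rewrite [X in X * _](lebesgue_measure_ball (v 0 0)%R (ltW r0)).
  by rewrite [X in _ * X]IH -EFinM exprS.
- exact: measurable_ball.
- exact: measurable_ball_row.
Qed.

End lebesgue_row_affine.

(** * From a Hessian bound to semiconvexity along segments *)

Section semiconvexity.
Variable R : realType.

Lemma convex_of_second_derivative (g g1 g2 : R -> R) (t : R) :
  (forall s : R, is_derive s 1 g (g1 s)) ->
  (forall s : R, is_derive s 1 g1 (g2 s)) ->
  (forall s, 0 <= g2 s) -> 0 <= t <= 1 ->
  g t <= (1 - t) * g 0 + t * g 1.
Proof.
move=> dg dg1 g2_ge0 /andP[t0 t1].
have Dg : 'D_1 g = g1 by apply/funext => s; case: (dg s).
have cg (s : R) : {for s, continuous g}.
  by apply/differentiable_continuous/derivable1_diffP; case: (dg s).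
have t0' : 0 <= 1 - t by rewrite subr_ge0.
have t1' : 1 - t <= 1 by rewrite gerBl.
have := @second_derivative_convex R g 0 1 _ _ _ _ _ (Itv01 t0' t1') ler01.
rewrite !convRE /= !(mulr0, mulr1, add0r) unstable.onemK; apply.
- by move=> x _; rewrite Dg; case: (dg1 x) => _ ->.
- exact/cvg_at_left_filter/cg.
- exact/cvg_at_right_filter/cg.
- by move=> x _; case: (dg x).
- by move=> x _; rewrite Dg; case: (dg1 x).
Qed.

Variable d : nat.
Implicit Types (V : 'rV[R]_d -> R) (x u v : 'rV[R]_d).

Lemma is_derive_line (f : 'rV[R]_d -> R) x u s : derivable f (x + s *: u) u ->
  is_derive s 1 (fun s : R => f (x + s *: u)) ('D_u f (x + s *: u)).
Proof.
have E : (fun h => h^-1 *: (((fun s : R => f (x + s *: u)) \o shift s) (h *: (1:R))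
      - f (x + s *: u))) =
   (fun h => h^-1 *: ((f \o shift (x + s *: u)) (h *: u) - f (x + s *: u))).
  apply/funext => h /=; congr (_ *: (f _ - _)).
  by rewrite [h *: 1]mulr1 scalerDl addrCA.
by move=> df; apply: DeriveDef; rewrite /derivable /derive E.
Qed.

Lemma deriveE_gradient V x u : differentiable V x ->
  'D_u V x = \sum_(j < d) u 0 j * gradient V x 0 j.
Proof.
move=> dV; rewrite deriveE// {1}[u]row_sum_delta linear_sum.
apply: eq_bigr => j _; rewrite linearZ mxE deriveE//.
Qed.

Lemma is_derive_gradient V x u : differentiable (gradient V) x ->
  is_derive x u (fun y => \sum_(j < d) u 0 j * gradient V y 0 j)
    ((u *m hessian V x *m u^T) 0 0).
Proof.
move=> dG; have dGu := diff_derivable dG (v := u).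
rewrite (_ : (fun y => _) =
    \sum_(j < d) (u 0 j *: (fun y => gradient V y 0 j))); last first.
  by apply/funext => y; rewrite fct_sumE.
apply: is_derive_eq.
  apply: is_derive_sum => j; apply: is_deriveZ; apply: derivableP.
  by move/derivable_mxP : dGu; apply.
rewrite mxE; apply: eq_bigr => j _.
by rewrite /hessian -deriveEjacobian// derive_mx// !mxE mulrC.
Qed.

Lemma enorm_sqr u : enorm u ^+ 2 = \sum_(i < d) u 0 i ^+ 2.
Proof. by rewrite sqr_sqrtr// sumr_ge0// => i _; rewrite sqr_ge0. Qed.

(** On the segment from [x] to [z], parametrised by [s], the function
    [V + K / 2 * |z - x| ^ 2 * s ^ 2] has a nonnegative second derivative. *)
Lemma semiconvex V (K t : R) x z : twice_differentiable V ->
  (forall x, loewner_le (- K *: 1%:M) (hessian V x)) -> 0 <= t <= 1 ->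
  V ((1 - t) *: x + t *: z) <=
    (1 - t) * V x + t * V z + K / 2 * (t * (1 - t)) * enorm (z - x) ^+ 2.
Proof.
move=> [dV dG] hess t01; set u := z - x; set N := enorm u ^+ 2.
pose q (s : R) := K / 2 * N * s ^+ 2.
have dq (s : R) : is_derive s 1 q (K * N * s).
  apply: is_derive_eq => /=.
  by rewrite /GRing.scale/= ; field.
have dq1 (s : R) : is_derive s 1 (fun s => K * N * s) (K * N).
  by apply: is_derive_eq; rewrite /GRing.scale/= mulr1.
pose D y := \sum_(j < d) u 0 j * gradient V y 0 j.
have ED y : 'D_u V y = D y by rewrite deriveE_gradient.
have dg (s : R) : is_derive s 1 (fun s => V (x + s *: u) + q s)
    (D (x + s *: u) + K * N * s).
  apply: is_deriveD; rewrite -ED; apply: is_derive_line.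
  exact/diff_derivable.
have dg1 (s : R) : is_derive s 1 (fun s => D (x + s *: u) + K * N * s)
    ((u *m hessian V (x + s *: u) *m u^T) 0 0 + K * N).
  apply: is_deriveD.
  have [dD ED1] := is_derive_gradient u (dG (x + s *: u)).
  by rewrite -ED1; apply: is_derive_line.
have g2_ge0 (s : R) :
    0 <= (u *m hessian V (x + s *: u) *m u^T) 0 0 + K * N.
  have := hess (x + s *: u) u.
  rewrite scaleNr opprK mulmxDr mulmxDl -scalemxAr mulmx1 -scalemxAl mxE.
  rewrite [X in 0 <= _ + X -> _]mxE; congr (0 <= _ + _ * _).
  by rewrite /N enorm_sqr mxE; apply: eq_bigr => i _; rewrite !mxE expr2.
have := convex_of_second_derivative dg dg1 g2_ge0 t01.
rewrite /q !(scale0r, addr0, scale1r) subrKC.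
rewrite (_ : x + t *: u = (1 - t) *: x + t *: z); last first.
  by rewrite /u scalerBr scalerBl scale1r addrCA addrC.
by rewrite expr0n/= mulr0 addr0 expr1n mulr1; lra.
Qed.
End semiconvexity.

(** * Sections of sets in a product space *)

Section fubini_sections.
Context d1 d2 (T1 : measurableType d1) (T2 : measurableType d2) (R : realType).
Local Open Scope ereal_scope.

Lemma product_measure_sym (m1 : {sigma_finite_measure set T1 -> \bar R})
    (m2 : {sigma_finite_measure set T2 -> \bar R}) (G : set (T1 * T2)) :
  measurable G -> (m1 \x m2) G = \int[m2]_y m1 (ysection G y).
Proof.
move=> mG; rewrite (@product_measure_unique _ _ _ _ _ m1 m2 (m1 \x^ m2))//.
by move=> A B mA mB; exact: product_measure2E.
Qed.

(** If every section over [D] is small, then an average section the other way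
    is small, hence one of them is. *)
Lemma exists_small_section (m1 : {sigma_finite_measure set T1 -> \bar R})
    (m2 : {sigma_finite_measure set T2 -> \bar R}) (G : set (T1 * T2))
    (D : set T1) (B : set T2) (a b : R) :
  measurable G -> measurable D -> measurable B -> (0 <= a)%R -> (0 <= b)%R ->
  (forall x, D x -> m2 (B `&` xsection G x) <= a%:E) ->
  a%:E * m1 D < b%:E * m2 B ->
  exists2 y, B y & m1 (D `&` ysection G y) <= b%:E.
Proof.
move=> mG mD mB a0 b0 aG ab; apply: contrapT => /forall2NP nby.
have mDB : measurable (G `&` D `*` B).
  by apply: measurableI => //; exact: measurableX.
suff : b%:E * m2 B <= a%:E * m1 D by rewrite leNgt ab.
apply: (@le_trans _ _ ((m1 \x m2) (G `&` D `*` B))).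
  rewrite product_measure_sym// -integral_cst//.
  apply: (@le_trans _ _ (\int[m2]_(y in B) m1 (ysection (G `&` D `*` B) y))).
    apply: ge0_le_integral => //.
    - by apply: measurable_funTS; exact: measurable_fun_ysection.
    - move=> y By; have [//|/negP] := nby y; rewrite -ltNge => /ltW.
      move=> /le_trans; apply; rewrite le_measure ?inE//.
      + by apply: measurableI => //; exact: measurable_ysection.
      + exact: measurable_ysection.
      + by move=> x [Dx]; rewrite /ysection/= !inE.
  apply: ge0_subset_integral => //; exact: measurable_fun_ysection.
rewrite /product_measure1/=.
rewrite [leRHS](_ : _ = \int[m1]_x (a%:E * (\1_D x)%:E)); last first.
  rewrite ge0_integralZl//.
  - by rewrite integral_indic// setIT.
  - by apply/measurable_EFinP; exact: measurable_indic.
apply: ge0_le_integral => //.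
- exact: measurable_fun_xsection.
- apply: emeasurable_funM => //.
  by apply/measurable_EFinP; exact: measurable_indic.
move=> x _ /=; rewrite indicE; have [Dx|nDx] := boolP (x \in D).
  rewrite mule1; move/set_mem : Dx => /aG; apply: le_trans.
  rewrite le_measure ?inE//.
  - exact: measurable_xsection.
  - by apply: measurableI => //; exact: measurable_xsection.
  - by move=> y; rewrite /xsection/= !inE => -[? []].
rewrite mule0 (_ : xsection _ _ = set0) ?measure0//; apply/seteqP; split => // y.
by rewrite /xsection/= inE => -[_ [/= Dx]]; rewrite mem_set in nDx.
Qed.

Lemma product_measure_le_sections (m1 : probability T1 R)
    (m2 : probability T2 R) (G1 G2 : set (T1 * T2)) A B (a : R) :
  measurable G1 -> measurable G2 -> measurable A -> measurable B ->
  A `*` B `<=` G1 `|` G2 -> (0 <= a)%R ->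
  (forall y, m1 (ysection G1 y) <= a%:E) ->
  (forall x, m2 (xsection G2 x) <= a%:E) -> m1 A * m2 B <= (a + a)%:E.
Proof.
move=> mG1 mG2 mA mB sub a0 h1 h2; rewrite -product_measure1E// EFinD.
apply: (@le_trans _ _ ((m1 \x m2) (G1 `|` G2))).
  by rewrite le_measure ?inE//; [exact: measurableX|exact: measurableU].
apply: (le_trans (measureU2 _ _ _)) => //; apply: leeD.
  rewrite [leLHS](product_measure_sym m1 m2 mG1).
  rewrite -[leRHS]mule1 -(@probability_setT _ _ _ m2).
  rewrite -integral_cst//; apply: ge0_le_integral => // [|y _]; last exact: h1.
  exact: measurable_fun_ysection.
rewrite -[leRHS]mule1 -(@probability_setT _ _ _ m1) -integral_cst//.
apply: ge0_le_integral => // [|x _]; last exact: h2.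
exact: measurable_fun_xsection.
Qed.

End fubini_sections.

(** * Contractions and the mass they carry across a boundary *)

Section slide.
Context (R : realType) (d : nat).
Implicit Types (x y z : 'rV[R]_d) (s t : R).

(** As a map of [x] it is the contraction of ratio [1 - s] towards [z]; as a
    function of [s] it runs through the segment from [x] to [z]. *)
Definition slide s z x := (1 - s) *: x + s *: z.

Lemma slide0 z x : slide 0 z x = x.
Proof. by rewrite /slide subr0 scale1r scale0r addr0. Qed.

Lemma slideB s t z x : slide s z x - slide t z x = (s - t) *: (z - x).
Proof.
rewrite /slide opprD addrACA -!scalerBl scalerBr addrC; congr (_ + _).
by rewrite -scaleNr; congr (_ *: _); ring.
Qed.

Lemma measurable_slide s z : measurable_fun setT (slide s z).
Proof. exact: measurable_affine_row. Qed.

Lemma measurable_slide2 s :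
  measurable_fun setT (fun p : 'rV[R]_d * 'rV[R]_d => slide s p.2 p.1).
Proof.
apply: measurable_fun_row => i.
under eq_fun do rewrite !mxE.
apply: measurable_funD; apply: measurable_funM => //.
  exact: (measurableT_comp (measurable_coord i) measurable_fst).
exact: (measurableT_comp (measurable_coord i) measurable_snd).
Qed.

Lemma enormZ t x : enorm (t *: x) = `|t| * enorm x.
Proof.
rewrite /enorm -sqrtr_sqr -sqrtrM ?sqr_ge0//; congr (Num.sqrt _).
by rewrite mulr_sumr; apply: eq_bigr => i _; rewrite !mxE exprMn.
Qed.

Lemma enorm_ge0 x : 0 <= enorm x.
Proof. exact: sqrtr_ge0. Qed.

Lemma enormN x : enorm (- x) = enorm x.
Proof. by rewrite -scaleN1r enormZ normrN1 mul1r. Qed.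

End slide.

Section weighted.
Context (R : realType) (d : nat) (V : 'rV[R]_d -> R).
Variable mu : probability 'rV[R]_d R.
Hypothesis Vcont : continuous V.
Hypothesis muE : forall A : set 'rV[R]_d, measurable A ->
  mu A = (\int[lebesgue_row R d]_(x in A) (expR (- V x))%:E)%E.
Local Open Scope ereal_scope.

Let rho x : \bar R := (expR (- V x))%:E.

Lemma measurable_density : measurable_fun setT (fun x => (expR (- V x))%:E).
Proof.
apply/measurable_EFinP; apply: continuous_measurable_row => x.
apply: continuous_comp; last exact: continuous_expR.
by apply: continuousN; exact: Vcont.
Qed.

Let mrho : measurable_fun setT rho := measurable_density.

Let rho_ge0 x : 0 <= rho x. Proof. by rewrite lee_fin expR_ge0. Qed.

Lemma integral_slide (s : R) (z : 'rV[R]_d) (E : set 'rV[R]_d) :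
  (s < 1)%R -> measurable E ->
  \int[lebesgue_row R d]_(x in slide s z @^-1` E) rho (slide s z x) =
  (((1 - s) ^+ d)^-1)%:E * mu E.
Proof.
move=> s1 mE; rewrite muE//.
have s0 : (0 < 1 - s)%R by rewrite subr_gt0.
have ms := measurable_slide s z.
rewrite -(@ge0_integral_pushforward _ _ _ _ _ _ ms (lebesgue_row R d) E rho)//;
  last exact: measurable_funTS.
have p0 : (0 <= ((1 - s) ^+ d)^-1)%R by rewrite invr_ge0 exprn_ge0// ltW.
rewrite -(ge0_integral_mscale (lebesgue_row R d) mE (NngNum p0))//.
  apply: eq_measure_integral => A mA _.
  rewrite /mscale /pushforward/=; exact: lebesgue_row_affine.
exact: measurable_funTS.
Qed.

(** Change of variables: a contraction of ratio at least [1 / 2] divides volumes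
    by at most [2 ^ d], and [C] compares the densities at [x] and at its image. *)
Lemma pullback_le (s C : R) (z : 'rV[R]_d) (D E : set 'rV[R]_d) :
  (0 <= s <= 2^-1)%R -> (0 <= C)%R -> measurable D -> measurable E ->
  (forall x, D x -> E (slide s z x) ->
     expR (- V x) <= C * expR (- V (slide s z x)))%R ->
  mu (D `&` slide s z @^-1` E) <= (C * 2 ^+ d)%:E * mu E.
Proof.
move=> /andP[s0 s1] C0 mD mE h.
have s_lt1 : (s < 1)%R by apply: le_lt_trans s1 _; rewrite invf_lt1 ?ltr1n.
have mT : measurable (slide s z @^-1` E).
  by apply: measurable_preimage => //; exact: measurable_slide.
have mI : measurable (D `&` slide s z @^-1` E) by exact: measurableI.
have mrs : measurable_fun setT (fun x => rho (slide s z x)).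
  exact: (measurableT_comp mrho (measurable_slide s z)).
rewrite muE//.
apply: (@le_trans _ _
  (\int[lebesgue_row R d]_(x in D `&` slide s z @^-1` E)
    (C%:E * rho (slide s z x)))).
  apply: ge0_le_integral => //.
  - exact: measurable_funTS.
  - by apply: measurable_funTS; exact: emeasurable_funM.
  - by move=> x [Dx Ex]; rewrite -EFinM lee_fin h.
apply: (@le_trans _ _
  (\int[lebesgue_row R d]_(x in slide s z @^-1` E)
    (C%:E * rho (slide s z x)))).
  apply: ge0_subset_integral => //.
    by apply: measurable_funTS; exact: emeasurable_funM.
  by move=> x _; rewrite mule_ge0// lee_fin.
rewrite ge0_integralZl//; last exact: measurable_funTS.
rewrite integral_slide// muleA -EFinM lee_wpmul2r// lee_fin ler_wpM2l//.
rewrite -exprVn lerXn2r ?nnegrE ?invr_ge0 ?subr_ge0 ?(ltW s_lt1)//.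
rewrite invf_ple ?posrE ?subr_gt0//; lra.
Qed.

Lemma exists_crossing (P : nat -> Prop) (n : nat) : P 0%N -> ~ P n ->
  exists2 k, (k < n)%N & P k /\ ~ P k.+1.
Proof.
elim: n => [//|n IH] P0 nPn; have [Pn|nP] := pselect (P n); first by exists n.
by have [k kn Pk] := IH P0 nP; exists k => //; exact: ltnW.
Qed.

(** A point of [E] carried outside [E] along its segment must, at one of
    [N.+1] small jumps, leave [E]; one end of that jump lies in [S]. So the set
    of these points is covered by the pullbacks of [S] under [N.+2]
    contractions, to which [pullback_le] applies. *)
Lemma crossing_le (E D S : set 'rV[R]_d) (s C h : R) (z : 'rV[R]_d) (N : nat) :
  (0 <= s <= 2^-1)%R -> (0 <= C)%R ->
  measurable D -> measurable S -> measurable E ->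
  (forall p q, E p -> ~ E q -> enorm (p - q) <= h -> S p \/ S q)%R ->
  (forall x, D x -> s * enorm (z - x) <= N.+1%:R * h)%R ->
  (forall x t, D x -> 0 <= t <= s ->
     expR (- V x) <= C * expR (- V (slide t z x)))%R ->
  mu (D `&` (E `&` slide s z @^-1` (~` E))) <=
    (N.+2%:R * (C * 2 ^+ d))%:E * mu S.
Proof.
move=> /andP[s0 s1] C0 mD mS mE hS step dens.
pose t k : R := (k%:R * (s / N.+1%:R))%R.
have tN : t N.+1 = s by rewrite /t mulrC divfK.
have t0 : t 0%N = 0%R by rewrite /t mul0r.
have t_ge0 k : (0 <= t k)%R by rewrite mulr_ge0// divr_ge0.
have t_le k : (k <= N.+1)%N -> (t k <= s)%R.
  by move=> kN; rewrite -[leRHS]tN ler_wpM2r ?divr_ge0// ler_nat.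
pose F k := D `&` slide (t k) z @^-1` S.
have mslide k (A : set 'rV[R]_d) : measurable A ->
    measurable (slide k z @^-1` A).
  by move=> mA; apply: measurable_preimage => //; exact: measurable_slide.
have mF k : measurable (F k) by apply: measurableI => //; exact: mslide.
have cover : D `&` (E `&` slide s z @^-1` (~` E)) `<=`
    \big[setU/set0]_(k < N.+2) F k.
  move=> x [Dx [Ex nEx]].
  have E0 : E (slide (t 0%N) z x) by rewrite t0 slide0.
  have nEN : ~ E (slide (t N.+1) z x) by rewrite tN.
  have [k kN [Ek nEk]] :=
    exists_crossing (P := fun k => E (slide (t k) z x)) E0 nEN.
  rewrite -bigcup_mkord.
  have /(hS _ _ Ek nEk) : (enorm (slide (t k) z x - slide (t k.+1) z x) <= h)%R.
    rewrite slideB enormZ distrC -mulrBl -natrB// subSnn mul1r.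
    by rewrite ger0_norm ?divr_ge0// mulrAC ler_pdivrMr// [leRHS]mulrC step.
  case=> Sk; first by exists k => //=; exact: ltnW.
  by exists k.+1.
apply: (le_trans (@content_subadditive _ _ _ mu _ F N.+2 _ _ cover)) => //.
  by do 2 apply: measurableI => //; apply: mslide; exact: measurableC.
apply: (@le_trans _ _ (\sum_(k < N.+2) (C * 2 ^+ d)%:E * mu S)).
  apply: lee_sum => k _; have kN : (k <= N.+1)%N by rewrite -ltnS.
  apply: pullback_le => //; first by rewrite t_ge0 (le_trans (t_le _ kN) s1).
  by move=> x Dx _; apply: dens => //; rewrite t_ge0 t_le.
by rewrite sumr_const card_ord [in leRHS]EFinM -[in leRHS]muleA mule_natl.
Qed.

End weighted.

(** * Balls, distances and boundary layers *)

Section ball_geometry.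
Context (R : realType) (d : nat).
Implicit Types (x y z c : 'rV[R]_d) (r : R).

Lemma row_ballP c r x : 0 < r ->
  ball c r x <-> forall i, `|c 0 i - x 0 i| < r.
Proof. by move=> r0; rewrite ball_rowP. Qed.

Lemma enorm_le_coord x r : 0 <= r -> (forall i, `|x 0 i| <= r) ->
  enorm x <= d.+1%:R * r.
Proof.
move=> r0 xr; have D0 : 0 <= d.+1%:R * r by rewrite mulr_ge0.
rewrite -(ger0_norm D0) -sqrtr_sqr ler_sqrt ?sqr_ge0//.
apply: (@le_trans _ _ (\sum_(i < d) r ^+ 2)).
  by apply: ler_sum => i _; rewrite -[x 0 i ^+ 2]real_normK ?num_real// lerXn2r ?nnegrE.
rewrite sumr_const card_ord -[leLHS]mulr_natl exprMn ler_wpM2r ?sqr_ge0//.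
by rewrite -natrX ler_nat -mulnn (leq_trans (leqnSn d))// leq_pmulr.
Qed.

Lemma coord_le_enorm x i : `|x 0 i| <= enorm x.
Proof.
rewrite -sqrtr_sqr ler_sqrt ?sumr_ge0// => [|j _]; last exact: sqr_ge0.
by rewrite (bigD1 i)//= lerDl sumr_ge0// => j _; exact: sqr_ge0.
Qed.

Lemma enorm_ball c r x z : 0 < r -> ball c r x -> ball c r z ->
  enorm (z - x) <= d.+1%:R * (2 * r).
Proof.
move=> r0 /(row_ballP _ _ r0) xr /(row_ballP _ _ r0) zr.
apply: enorm_le_coord => [|i]; first by rewrite mulr_ge0// ltW.
rewrite !mxE (le_trans (ler_distD (c 0 i) _ _))// mulr_natl mulr2n.
by apply: lerD; [rewrite distrC|]; exact/ltW.
Qed.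

Lemma enorm_ge_ball c r x : 0 < r -> ~ ball c r x -> r <= enorm (x - c).
Proof.
move=> r0; rewrite row_ballP// => /existsNP[i /negP]; rewrite -leNgt => h.
apply: (le_trans h); rewrite distrC.
by have := coord_le_enorm (x - c) i; rewrite !mxE.
Qed.

Lemma continuous_enorm c : continuous (fun x => enorm (x - c)).
Proof.
move=> x; apply: (@continuous_comp _ _ _
  (fun x => \sum_(i < d) (x - c) 0 i ^+ 2) Num.sqrt); last exact: sqrt_continuous.
rewrite (_ : (fun x => _) = \sum_(i < d) (fun x => (x 0 i - c 0 i) ^+ 2)); last first.
  by apply/funext => y; rewrite fct_sumE; apply: eq_bigr => i _; rewrite !mxE.
apply: (big_ind (fun f : 'rV[R]_d -> R => {for x, continuous f})).
- exact: cst_continuous.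
- by move=> f g cf cg; exact: continuousD.
- move=> i _.
  have ci : {for x, continuous (fun y : 'rV[R]_d => y 0 i - c 0 i)}.
    apply: (@continuousB _ _ _ (fun y : 'rV[R]_d => y 0 i) (fun=> c 0 i)).
      exact: coord_continuous.
    exact: cst_continuous.
  exact: (continuous_comp ci (@exprn_continuous R 2 _)).
Qed.

Lemma bounded_above_on_ball (V : 'rV[R]_d -> R) c r : continuous V -> 0 < r ->
  exists C, forall x, ball c r x -> V x <= C.
Proof.
move=> cV r0.
pose K := [set v : 'rV[R]_d | forall i, `[c 0 i - r, c 0 i + r]%classic (v 0 i)].
have cK : compact K.
  exact: (@rV_compact R d (fun i => `[c 0 i - r, c 0 i + r]%classic)
    (fun i => @segment_compact R _ _)).
have K0 : K !=set0.
  by exists c => i /=; rewrite in_itv/= lerBlDr lerDl ltW//=.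
have [m _ Vm] := compact_EVT_max K0 cK (continuous_subspaceT cV).
exists (V m) => x /(row_ballP _ _ r0) xr; apply: Vm; rewrite inE => i /=.
rewrite in_itv/= -ler_distl distrC; exact/ltW.
Qed.

End ball_geometry.

Section enlargement.
Context (R : realType) (d : nat).
Implicit Types (A E S : set 'rV[R]_d) (h : R).

(** The condition is symmetric under complementation of [E], so that the outer
    layer of [A] can be used both for [A] and for its complement. This is how
    the one-sided boundary measure controls large sets as well as small ones. *)
Definition separates E S h :=
  forall p q, E p -> ~ E q -> enorm (p - q) <= h -> S p \/ S q.

Definition outer_layer A h := [set x | ~ A x /\ (set_dist x A <= h%:E)%E].

(** The sublevel set of the distance is a countable intersection of unions of
    open balls. *)
Lemma measurable_outer_layer A h : measurable A -> measurable (outer_layer A h).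
Proof.
move=> mA.
rewrite (_ : outer_layer A h = ~` A `&` [set x | (set_dist x A <= h%:E)%E])//.
apply: measurableI; first exact: measurableC.
rewrite (_ : [set x | _] = \bigcap_(n : nat)
    \bigcup_(a in A) [set x | enorm (x - a) < h + n.+1%:R^-1]).
  apply: bigcapT_measurable => n; apply: open_measurable_row.
  apply: bigcup_open => a _.
  have /continuousP/(_ _ (@open_lt R (h + n.+1%:R^-1))) := @continuous_enorm R d a.
  by [].
apply/seteqP; split => x /=.
  move=> xh n _; have : (set_dist x A < (h + n.+1%:R^-1)%:E)%E.
    by apply: (le_lt_trans xh); rewrite lte_fin ltrDl invr_gt0.
  by move=> /ereal_inf_lt[_ [a Aa <-]]; rewrite lte_fin => ?; exists a.
move=> h1; apply/lee_addgt0Pr => e e0.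
have [n ne] : exists n : nat, n.+1%:R^-1 < e.
  exists (Num.truncn e^-1); rewrite invf_plt ?posrE//; exact: truncnS_gt.
have [a Aa xa] := h1 n I.
apply: (@le_trans _ _ (enorm (x - a))%:E).
  by apply: ereal_inf_lbound; exists a.
by rewrite -EFinD lee_fin ltW// (lt_trans xa)// ltrD2l.
Qed.

Lemma separates_outer_layer A h : separates A (outer_layer A h) h.
Proof.
move=> p q Ap Aq pq; right; split => //.
apply: ge_ereal_inf; exists (enorm (q - p))%:E; first by exists p.
by rewrite lee_fin -opprB enormN.
Qed.

Lemma separatesC E S h : separates E S h -> separates (~` E) S h.
Proof.
move=> sE p q nEp /contrapT Eq pq.
have /(sE q p Eq nEp)[] : enorm (q - p) <= h by rewrite -opprB enormN.
  by right.
by left.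
Qed.

Lemma boundary_measure_ge (mu : set 'rV[R]_d -> \bar R) A (c h0 : R) : 0 < h0 ->
  (forall h, 0 < h < h0 -> (c%:E <= h^-1%:E * mu (outer_layer A h))%E) ->
  (c%:E <= boundary_measure mu A)%E.
Proof.
move=> h00 H; rewrite /boundary_measure limf_einfE.
apply: le_ereal_sup_tmp.
exists (ereal_inf [set (h^-1%:E * mu (outer_layer A h))%E |
    h in [set h : R | 0 < h < h0]]).
  exists [set h : R | 0 < h < h0] => //.
  near=> h; apply/andP; split; near: h.
    exact: nbhs_right_gt.
  exact: nbhs_right_lt.
by apply: le_ereal_inf_tmp => _ [h hh0 <-]; exact: H.
Unshelve. all: by end_near. Qed.

End enlargement.

(** * The flux of mass out of a small set *)

Section potential.
Context (R : realType) (d : nat) (V : 'rV[R]_d -> R).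
Variable mu : probability 'rV[R]_d R.
Variables (K : R) (x0 : 'rV[R]_d).
Hypothesis Vcont : continuous V.
Hypothesis muE : forall A : set 'rV[R]_d, measurable A ->
  mu A = (\int[lebesgue_row R d]_(x in A) (expR (- V x))%:E)%E.
Hypothesis K0 : 0 <= K.
Hypothesis Vsc : forall x z t, 0 <= t <= 1 ->
  V (slide t z x) <=
    (1 - t) * V x + t * V z + K * (t * (1 - t)) * enorm (z - x) ^+ 2.
Variable C1 : R.
Hypothesis C1_ge0 : 0 <= C1.
Hypothesis V_le_C1 : forall x, ball x0 1 x -> V x <= C1.

(** Times [t * r ^ 2], it bounds the failure of convexity of [V] at parameter
    [t] on a chord of the ball of radius [r]. *)
Definition chord_defect : R := 4 * K * d.+1%:R ^+ 2.
Let Q := chord_defect.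

Lemma chord_defect_ge0 : 0 <= chord_defect.
Proof. by rewrite !mulr_ge0// ?sqr_ge0. Qed.
Let Q0 := chord_defect_ge0.

(** Times [r ^ 2], it bounds [- V] on the ball of radius [r]. *)
Definition potential_floor : R := 3 * (C1 - V x0) + chord_defect.
Let B := potential_floor.

Lemma potential_floor_ge0 : 0 <= potential_floor.
Proof.
by rewrite addr_ge0// mulr_ge0// subr_ge0 V_le_C1//; exact: ballxx.
Qed.
Let B0 := potential_floor_ge0.

Lemma slide_potential_le r x z t : 0 < r -> ball x0 r x -> ball x0 r z ->
  0 <= t <= 1 ->
  V (slide t z x) <= (1 - t) * V x + t * V z + t * (chord_defect * r ^+ 2).
Proof.
move=> r0 xr zr t01; apply: (le_trans (Vsc x z t01)); rewrite lerD2l.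
have /andP[t0 t1] := t01.
rewrite (_ : t * (Q * r ^+ 2) = K * (t * 1) * (d.+1%:R * (2 * r)) ^+ 2); last first.
  by rewrite /Q /chord_defect; ring.
rewrite ler_pM ?sqr_ge0 ?mulr_ge0 ?subr_ge0//.
  by rewrite ler_wpM2l// ler_wpM2l// gerBl.
rewrite lerXn2r ?nnegrE ?enorm_ge0 ?mulr_ge0 ?(ltW r0)//.
exact: (enorm_ball r0 xr zr).
Qed.

(** The centre [x0] lies on the segment from [x] to a point [w] of the unit
    ball, where [V] is bounded above; semiconvexity on that segment bounds
    [V x] from below. *)
Lemma potential_ge r x : 1 <= r -> ball x0 r x ->
  - (potential_floor * r ^+ 2) <= V x.
Proof.
move=> r1 xr; have r0 : 0 < r by exact: lt_le_trans r1.
have r2 : 0 < 2 * r by rewrite mulr_gt0.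
pose w := x0 - (2 * r)^-1 *: (x - x0).
have w1 : ball x0 1 w.
  apply/row_ballP => // i; rewrite !mxE subKr.
  rewrite normrM gtr0_norm ?invr_gt0// mulrC ltr_pdivrMr// mul1r distrC.
  have /(row_ballP _ _ r0)/(_ i) xi := xr.
  by rewrite (lt_trans xi)// mulr_natl mulr2n ltrDl.
have wr : ball x0 r w by exact: le_ball w1.
pose t := (2 * r + 1)^-1.
have t0 : 0 < t by rewrite invr_gt0 addr_gt0.
have tE : t * (2 * r + 1) = 1 by rewrite mulVf// gt_eqF// addr_gt0.
have t1 : t <= 1 by rewrite invf_le1 ?addr_gt0// lerDr ltW.
have xE : slide t x w = x0.
  apply/rowP => i; rewrite /slide /w /t !mxE; field.
  by rewrite !gt_eqF// addr_gt0.
have := @slide_potential_le r w x t r0 wr xr.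
rewrite xE ltW// t1 => /(_ isT) h.
have Vw : (1 - t) * V w <= C1.
  have [Vw|Vw] := leP 0 (V w).
    apply: (le_trans _ (V_le_C1 w1)); rewrite ler_piMl// gerBl ltW//.
  by rewrite (le_trans _ C1_ge0)// mulr_ge0_le0 ?subr_ge0// ltW.
have {}h : V x0 <= C1 + t * (V x + Q * r ^+ 2).
  by rewrite mulrDr; move: h Vw; rewrite -/Q; lra.
have {}h : V x0 * (2 * r + 1) <= C1 * (2 * r + 1) + (V x + Q * r ^+ 2).
  have := ler_wpM2r (ltW (addr_gt0 r2 ltr01)) h.
  by rewrite [leRHS]mulrDl [t * _ * _]mulrAC tE mul1r.
have rr : 2 * r + 1 <= 3 * r ^+ 2 by rewrite expr2; nra.
have C10 : 0 <= C1 - V x0 by rewrite subr_ge0 V_le_C1//; exact: ballxx.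
have := ler_wpM2l C10 rr; rewrite /B /potential_floor -/Q; nra.
Qed.

(** Along the contraction towards the unit ball the density can only drop by
    a bounded factor, as long as [s * r ^ 2] stays bounded. *)
Lemma slide_density_ge r s t x z : 1 <= r -> 0 <= t <= s -> s <= 1 ->
  ball x0 r x -> ball x0 1 z ->
  s * ((potential_floor + C1 + chord_defect) * r ^+ 2) <= 1 ->
  expR (- V x) <= expR 1 * expR (- V (slide t z x)).
Proof.
move=> r1 /andP[t0 ts] s1 xr z1 small; rewrite -expRD ler_expR.
have r0 : 0 < r by exact: lt_le_trans r1.
have zr : ball x0 r z by exact: le_ball z1.
have t1 : t <= 1 by exact: le_trans ts s1.
have t01 : 0 <= t <= 1 by rewrite t0 t1.
have h := slide_potential_le r0 xr zr t01.
have hx := ler_wpM2l t0 (potential_ge r1 xr).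
have hz := ler_wpM2l t0 (V_le_C1 z1).
have rr : 1 <= r ^+ 2 by rewrite expr_ge1// ltW.
have hc := ler_wpM2l (mulr_ge0 t0 C1_ge0) rr.
have P0 : 0 <= (B + C1 + Q) * r ^+ 2.
  by rewrite mulr_ge0 ?sqr_ge0// addr_ge0// addr_ge0.
have := ler_wpM2r P0 ts.
move: h hx hz hc small; rewrite -/B -/Q; lra.
Qed.

Lemma expR1_ge2 : 2 <= expR 1 :> R.
Proof. by rewrite (le_trans _ (expR_ge1Dx _)). Qed.

(** Contract towards a point [z] of the unit ball, by a factor close to one. A
    definite part of a set [E] of measure [e ^ (- L)] then leaves [E], for two
    reasons. Where [V > L / 2], the contraction multiplies the density by
    [e ^ (d + 2)] at least, since [s * L = 2 * (3 + d)]; this beats the volume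
    loss [2 ^ d] by a factor 4, so that points staying in [E] have measure at
    most a quarter of that of [E]. Where [V <= L / 2], the image of [x] for
    random [z] is uniformly distributed on a small cube, in which the part of
    [E] with comparable density is negligible because its volume is at most of
    order [e ^ (- L / 2)]; so most [z] carry [x] out of [E], and Fubini's
    theorem provides one [z] suitable for most [x]. *)
Lemma tail_flux (E : set 'rV[R]_d) (L r s : R) :
  measurable E -> mu E = (expR (- L))%:E -> 1 <= r -> 0 < s <= 2^-1 ->
  s * L = 2 * (3 + d%:R) ->
  (mu (~` ball x0 r) <= (expR (- L) / 4)%:E)%E ->
  s * ((potential_floor + C1 + chord_defect) * r ^+ 2) <= 1 ->
  s ^- d * expR (1 - L / 2) <= 8^-1 ->
  exists2 z, ball x0 1 z &
    ((expR (- L) / 4)%:E <= mu (ball x0 r `&` (E `&` slide s z @^-1` (~` E))))%E.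
Proof.
move=> mE muEL r1 /andP[s0 s2] sL far small vol.
have r0 : 0 < r by exact: lt_le_trans r1.
have s1 : s <= 1 by lra.
have s01 : 0 <= s <= 1 by rewrite (ltW s0) s1.
have L0 : 0 <= L by rewrite -(pmulr_rge0 _ s0) sL mulr_ge0// addr_ge0.
have rr : 1 <= r ^+ 2 by rewrite expr_ge1// ltW.
have mV : measurable_fun setT (V : _ -> measurableTypeR R).
  exact: continuous_measurable_row.
have msl z (A : set 'rV[R]_d) : measurable A -> measurable (slide s z @^-1` A).
  by move=> mA; apply: measurable_preimage => //; exact: measurable_slide.
have mlow a : measurable [set x | V x <= a].
  rewrite (_ : [set x | _] = V @^-1` `]-oo, a]%classic); last first.
    by apply/seteqP; split => x /=; rewrite in_itv.
  exact: measurable_preimage.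
have drop : s * (C1 + Q * r ^+ 2) <= 1.
  apply: le_trans small; rewrite ler_wpM2l ?(ltW s0)//.
  have := ler_wpM2l C1_ge0 rr; have := mulr_ge0 B0 (sqr_ge0 r).
  by rewrite -/B -/Q; lra.
have slideV x z : ball x0 r x -> ball x0 1 z ->
    V (slide s z x) <= (1 - s) * V x + 1.
  move=> xr z1; have zr : ball x0 r z by exact: le_ball z1.
  have := slide_potential_le r0 xr zr s01.
  have := ler_wpM2l (ltW s0) (V_le_C1 z1); move: drop; rewrite -/Q; lra.
pose A1 := E `&` ball x0 r `&` [set x | V x <= L / 2].
pose A2 := E `&` ball x0 r `&` ~` [set x | V x <= L / 2].
have mEb : measurable (E `&` ball x0 r).
  by apply: measurableI => //; exact: measurable_ball_row.
have mA1 : measurable A1 by exact: measurableI.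
have mA2 : measurable A2 by apply: measurableI => //; exact: measurableC.
(* where V is high, the contraction multiplies mass *)
have gain z : ball x0 1 z ->
    (mu (A2 `&` slide s z @^-1` E) <= (expR (- L) / 4)%:E)%E.
  move=> z1.
  have c0 : 0 <= expR (- (2 + d%:R)) :> R by exact: expR_ge0.
  apply: (le_trans (pullback_le Vcont muE
    (C := expR (- (2 + d%:R))) _ _ _ _ _)) => //.
  - by rewrite ltW.
  - move=> x [[_ xr] /negP]; rewrite -ltNge => Vx _.
    rewrite -expRD ler_expR.
    have := slideV x z xr z1; have := ler_wpM2l (ltW s0) (ltW Vx).
    rewrite mulrA sL; lra.
  rewrite muEL -EFinM lee_fin mulrC ler_wpM2l ?expR_ge0//.
  have eE : expR (2 + d%:R) = expR 1 ^+ (2 + d) :> R.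
    by rewrite -expRM_natl mulr1 natrD.
  have e2 : (4 * 2 ^+ d : R) <= expR 1 ^+ (2 + d).
    rewrite (_ : 4 * 2 ^+ d = 2 ^+ (2 + d)); last by rewrite exprD; lra.
    by rewrite lerXn2r ?nnegrE ?expR_ge0// expR1_ge2.
  rewrite expRN eE ler_pdivrMl ?exprn_gt0 ?expR_gt0//; move: e2; lra.
(* where V is low, for most centres z the contraction carries x out of E *)
have [z z1 loss] : exists2 z, ball x0 1 z &
    (mu (A1 `&` slide s z @^-1` E) <= (expR (- L) / 4)%:E)%E.
  pose G := [set p : 'rV[R]_d * 'rV[R]_d | E (slide s p.2 p.1)].
  have mG : measurable G.
    apply: (@measurable_preimage _ _ _ _
      (fun p : 'rV[R]_d * 'rV[R]_d => slide s p.2 p.1)) => //.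
    exact: measurable_slide2.
  pose E3 := E `&` [set x | V x <= L / 2 + 1].
  have mE3 : measurable E3 by exact: measurableI.
  have E3vol : (lebesgue_row R d E3 <= (expR (1 - L / 2))%:E)%E.
    have : ((expR (- (L / 2 + 1)))%:E * lebesgue_row R d E3 <= mu E)%E.
      apply: (@le_trans _ _ (mu E3)).
        2: by rewrite le_measure ?inE//; exact: subIsetl.
      rewrite muE// -integral_cst//; apply: ge0_le_integral => //.
      - by move=> x _; rewrite lee_fin expR_ge0.
      - by apply: measurable_funTS; exact: measurable_density.
      - by move=> x [_ Vx]; rewrite lee_fin ler_expR lerN2.
    rewrite muEL -lee_pdivlMl ?expR_gt0// => /le_trans; apply.
    by rewrite -EFinM -expRN -expRD lee_fin ler_expR; lra.
  have a0 : 0 <= s ^- d * expR (1 - L / 2).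
    by rewrite mulr_ge0 ?expR_ge0 ?invr_ge0 ?exprn_ge0 ?(ltW s0).
  suff [z z1 hz] : exists2 z, ball x0 1 z &
      (mu (A1 `&` ysection G z) <= (expR (- L) / 4)%:E)%E.
    exists z => //; rewrite (_ : _ @^-1` _ = ysection G z)//.
    by apply/seteqP; split=> x; rewrite /ysection/= inE.
  apply: (@exists_small_section _ _ _ _ R mu (lebesgue_row R d) G A1 (ball x0 1)
    (s ^- d * expR (1 - L / 2)) (expR (- L) / 4)) => //.
  - exact: measurable_ball_row.
  - move=> x [[Ex xr] Vx].
    apply: (@le_trans _ _ (lebesgue_row R d
        ((fun v => s *: v + (1 - s) *: x) @^-1` E3))).
      rewrite le_measure ?inE//.
      + apply: measurableI; first exact: measurable_ball_row.
        exact: measurable_xsection.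
      + by apply: measurable_preimage => //; exact: measurable_affine_row.
      + move=> v [v1]; rewrite /xsection/= inE /G/= => Ev.
        have vE : s *: v + (1 - s) *: x = slide s v x by rewrite addrC.
        split; rewrite /= vE//; apply: (le_trans (slideV _ _ xr v1)).
        rewrite lerD2r; have [V0|V0] := leP 0 (V x).
          by rewrite (le_trans _ Vx)// ler_piMl// gerBl ltW.
        rewrite (@le_trans _ _ 0)//; first by rewrite mulr_ge0_le0 ?subr_ge0// ltW.
        by rewrite divr_ge0.
    rewrite lebesgue_row_affine// EFinM lee_wpmul2l// lee_fin.
    by rewrite invr_ge0 exprn_ge0// ltW.
  - rewrite lebesgue_row_ball// -EFinM.
    apply: (@le_lt_trans _ _ ((s ^- d * expR (1 - L / 2))%:E * (expR (- L))%:E)%E).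
      rewrite lee_wpmul2l ?lee_fin// -muEL le_measure ?inE//.
      by move=> x [[]].
    rewrite -EFinM lte_fin.
    have e0 := expR_gt0 (- L).
    apply: (le_lt_trans (ler_wpM2r (ltW e0) vol)).
    have : 1 <= (1 *+ 2 : R) ^+ d by rewrite exprn_ege1// ler1n.
    nra.
exists z => //.
have mb : measurable (ball x0 r) by exact: measurable_ball_row.
have mc : measurable (ball x0 r `&` (E `&` slide s z @^-1` (~` E))).
  by do 2 apply: measurableI => //; apply: msl; exact: measurableC.
have mA1E : measurable (A1 `&` slide s z @^-1` E).
  by apply: measurableI => //; exact: msl.
have mA2E : measurable (A2 `&` slide s z @^-1` E).
  by apply: measurableI => //; exact: msl.
have cover : E `<=` (ball x0 r `&` (E `&` slide s z @^-1` (~` E))) `|`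
    (~` ball x0 r `|` (A1 `&` slide s z @^-1` E `|` A2 `&` slide s z @^-1` E)).
  move=> x Ex; have [xr|nxr] := pselect (ball x0 r x); last by right; left.
  have [Ez|nEz] := pselect (E (slide s z x)); last by left.
  by right; right; have [Vx|Vx] := pselect (V x <= L / 2); [left|right].
have mnb : measurable (~` ball x0 r) by exact: measurableC.
have : (mu E <= mu (ball x0 r `&` (E `&` slide s z @^-1` (~` E))) +
    (expR (- L) / 4 + (expR (- L) / 4 + expR (- L) / 4))%:E)%E.
  apply: (le_trans (le_measure _ _ _ cover)); rewrite ?inE//.
    by do 3 apply: measurableU => //.
  apply: (le_trans (measureU2 _ _ _)) => //.
    by do 2 apply: measurableU => //.
  rewrite leeD2l// !EFinD.
  apply: (le_trans (measureU2 _ _ _)) => //; first exact: measurableU.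
  apply: leeD => //; apply: (le_trans (measureU2 _ _ _)) => //.
  by apply: leeD => //; exact: gain.
rewrite muEL -leeBlDr// -EFinB => /(le_trans _); apply.
by rewrite lee_fin; lra.
Qed.
End potential.

(** * From flux to boundary layers *)

Section flux_to_perimeter.
Context (R : realType) (d : nat) (V : 'rV[R]_d -> R).
Variable mu : probability 'rV[R]_d R.
Variable x0 : 'rV[R]_d.
Hypothesis Vcont : continuous V.
Hypothesis muE : forall A : set 'rV[R]_d, measurable A ->
  mu A = (\int[lebesgue_row R d]_(x in A) (expR (- V x))%:E)%E.

(** [crossing_le] with jumps of length about [h]: paths in the ball of radius
    [r] have length at most [2 * d.+1 * s * r], which accounts for the factor
    [s * r / h]. *)
Lemma crossing_rate (E S : set 'rV[R]_d) (r s C h : R) (z : 'rV[R]_d) :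
  measurable E -> measurable S -> separates E S h ->
  0 < r -> ball x0 r z -> 0 <= s <= 2^-1 -> 0 <= C ->
  0 < h <= s * (d.+1%:R * (2 * r)) ->
  (forall x t, ball x0 r x -> 0 <= t <= s ->
     expR (- V x) <= C * expR (- V (slide t z x))) ->
  (mu (ball x0 r `&` (E `&` slide s z @^-1` (~` E))) <=
    (6 * d.+1%:R * s * r * C * 2 ^+ d / h)%:E * mu S)%E.
Proof.
move=> mE mS sep r0 zr s01 C0 /andP[h0 hs] dens.
set X := s * (d.+1%:R * (2 * r)) / h.
have X1 : 1 <= X by rewrite /X ler_pdivlMr// mul1r.
have XN := truncnS_gt X.
have NX : (Num.truncn X)%:R <= X by rewrite truncn_le (le_trans ler01).
have /andP[s0 _] := s01.
apply: (le_trans (@crossing_le _ _ _ _ Vcont muE E (ball x0 r) S s C h z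
  (Num.truncn X) s01 C0 (measurable_ball_row _ _) mS mE sep _ dens)).
  move=> x xr; apply: (@le_trans _ _ (X * h)); last by rewrite ler_wpM2r ?ltW.
  rewrite /X divfK ?gt_eqF// ler_wpM2l//; exact: (enorm_ball r0 xr zr).
rewrite lee_wpmul2r// lee_fin.
apply: (@le_trans _ _ (3 * X * (C * 2 ^+ d))).
  rewrite ler_wpM2r ?mulr_ge0 ?exprn_ge0//.
  rewrite -addn2 natrD; lra.
by rewrite /X le_eqVlt; apply/orP; left; apply/eqP; field; rewrite gt_eqF.
Qed.

(** A relative isoperimetric inequality in a ball. For [x] in [E] and [z]
    outside, the midpoint [m] is on one side or the other: either the path from
    [x] to [m] leaves [E], or the path from [z] to [m] enters it. Stopping
    halfway keeps the contractions nondegenerate. *)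
Lemma midpoint_flux (E S : set 'rV[R]_d) (r C h a : R) :
  measurable E -> measurable S -> separates E S h ->
  0 < r -> 0 <= C -> 0 < h <= d.+1%:R * r -> 0 <= a ->
  (forall x z t, ball x0 r x -> ball x0 r z -> 0 <= t <= 2^-1 ->
     expR (- V x) <= C * expR (- V (slide t z x))) ->
  (a%:E <= mu (E `&` ball x0 r))%E -> (a%:E <= mu (~` E `&` ball x0 r))%E ->
  ((a ^+ 2)%:E <= (6 * d.+1%:R * r * C * 2 ^+ d / h)%:E * mu S)%E.
Proof.
move=> mE mS sep r0 C0 /andP[h0 hr] a0 dens aE anE.
have [m mm] : exists m : R, mu S = m%:E.
  by exists (fine (mu S)); rewrite fineK// fin_num_measure.
have m0 : 0 <= m by rewrite -lee_fin -mm.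
set H : R := 2^-1.
have H01 : 0 <= H <= H by rewrite lexx andbT /H invr_ge0.
have hs : 0 < h <= H * (d.+1%:R * (2 * r)).
  by rewrite h0 (le_trans hr)// /H; lra.
pose y := 6 * d.+1%:R * H * r * C * 2 ^+ d / h * m.
have y0 : 0 <= y.
  rewrite /y /H; repeat apply: mulr_ge0 => //; rewrite ?invr_ge0 ?exprn_ge0//.
  - exact: ltW r0.
  - exact: ltW h0.
have slideC (x z : 'rV[R]_d) : slide H x z = slide H z x.
  by rewrite /slide (_ : 1 - H = H) 1?addrC// /H; lra.
have mb : measurable (ball x0 r) by exact: measurable_ball_row.
have mpre (A : set 'rV[R]_d) : measurable A ->
    measurable [set p : 'rV[R]_d * 'rV[R]_d | A (slide H p.2 p.1)].
  move=> mA; apply: (@measurable_preimage _ _ _ _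
    (fun p : 'rV[R]_d * 'rV[R]_d => slide H p.2 p.1)) => //.
  exact: measurable_slide2.
pose G1 := (E `&` ball x0 r) `*` ball x0 r `&`
  [set p : 'rV[R]_d * 'rV[R]_d | (~` E) (slide H p.2 p.1)].
pose G2 := ball x0 r `*` (~` E `&` ball x0 r) `&`
  [set p : 'rV[R]_d * 'rV[R]_d | E (slide H p.2 p.1)].
have mnE : measurable (~` E) by exact: measurableC.
have mG1 : measurable G1.
  by apply: measurableI; [apply: measurableX => //; exact: measurableI|exact: mpre].
have mG2 : measurable G2.
  by apply: measurableI; [apply: measurableX => //; exact: measurableI|exact: mpre].
have msl z (A : set 'rV[R]_d) : measurable A -> measurable (slide H z @^-1` A).
  by move=> mA; apply: measurable_preimage => //; exact: measurable_slide.
have dens' z x t : ball x0 r z -> ball x0 r x -> 0 <= t <= H ->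
    expR (- V x) <= C * expR (- V (slide t z x)) by move=> *; exact: dens.
have : (mu (E `&` ball x0 r) * mu (~` E `&` ball x0 r) <= (y + y)%:E)%E.
  apply: (@product_measure_le_sections _ _ _ _ _ mu mu G1 G2) => //.
  - exact: measurableI.
  - exact: measurableI.
  - move=> [x z] [/= [Ex xr] [nEz zr]].
    by have [Em|nEm] := pselect (E (slide H z x)); [right|left].
  - move=> z; have [zr|nzr] := pselect (ball x0 r z); last first.
      rewrite (_ : ysection _ _ = set0) ?measure0 ?lee_fin//.
      by apply/seteqP; split => // x; rewrite /ysection/= inE => -[[_ /=]].
    apply: (@le_trans _ _ (mu (ball x0 r `&` (E `&` slide H z @^-1` (~` E))))).
      rewrite le_measure ?inE//; first exact: measurable_ysection.
        by do 2 apply: measurableI => //; exact: msl.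
      by move=> x; rewrite /ysection/= inE => -[[[/= ? ?] _] ?].
    rewrite /y EFinM -mm.
    exact: (crossing_rate mE mS sep r0 zr H01 C0 hs (fun x t => @dens' z x t zr)).
  - move=> x; have [xr|nxr] := pselect (ball x0 r x); last first.
      rewrite (_ : xsection _ _ = set0) ?measure0 ?lee_fin//.
      by apply/seteqP; split => // z; rewrite /xsection/= inE => -[[/=]].
    apply: (@le_trans _ _ (mu (ball x0 r `&` (~` E `&` slide H x @^-1` (~` ~` E))))).
      rewrite setCK le_measure ?inE//; first exact: measurable_xsection.
        by do 2 apply: measurableI => //; exact: msl.
      by move=> z; rewrite /xsection/= inE /= slideC => -[[/= ? [? ?]] ?].
    rewrite /y EFinM -mm.
    exact: (crossing_rate mnE mS (separatesC sep) r0 xr H01 C0 hs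
      (fun z t => @dens' x z t xr)).
rewrite mm -EFinM (_ : y + y = 6 * d.+1%:R * r * C * 2 ^+ d / h * m); last first.
  by rewrite /y /H; field; rewrite gt_eqF.
apply: le_trans; rewrite expr2 EFinM.
by apply: lee_pmul => //; rewrite lee_fin.
Qed.
End flux_to_perimeter.

(** * Lower bounds for boundary layers *)

Section exponential_moment.
Context (R : realType) (d : nat) (mu : probability 'rV[R]_d R).
Variables (eps alpha : R) (x0 : 'rV[R]_d).
Hypotheses (eps_gt0 : 0 < eps) (alpha_ge1 : 1 <= alpha).
Hypothesis mu_exp :
  (\int[mu]_x (expR (eps * enorm (x - x0) `^ alpha))%:E < +oo)%E.

Lemma tail_mass : exists2 M : R, 0 <= M & forall r, 0 < r ->
  (mu (~` ball x0 r) <= (M / expR (eps * r `^ alpha))%:E)%E.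
Proof.
have Ifin := mu_exp; set I := (\int[mu]_x _)%E in Ifin.
have I0 : (0 <= I)%E by apply: integral_ge0 => x _; rewrite lee_fin expR_ge0.
exists (fine I) => [|r r0]; first exact: fine_ge0.
have mf : measurable_fun setT
    (fun x : 'rV[R]_d => (expR (eps * enorm (x - x0) `^ alpha))%:E).
  apply/measurable_EFinP.
  have mn : measurable_fun setT
      (fun x : 'rV[R]_d => enorm (x - x0) : measurableTypeR R).
    by apply: continuous_measurable_row; exact: continuous_enorm.
  have mp := measurableT_comp (measurable_powR alpha) mn.
  have me : measurable_fun setT
      (fun x : 'rV[R]_d => eps * enorm (x - x0) `^ alpha : measurableTypeR R).
    by apply: measurable_funM.
  exact: (measurableT_comp (@measurable_expR R) me).
have mb : measurable (~` ball x0 r).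
  by apply: measurableC; exact: measurable_ball_row.
rewrite mulrC EFinM lee_pdivlMl ?expR_gt0// fineK ?ge0_fin_numE//.
apply: (@le_trans _ _
  (\int[mu]_(x in ~` ball x0 r) cst (expR (eps * r `^ alpha))%:E x)%E).
  by rewrite integral_cst.
apply: (@le_trans _ _
  (\int[mu]_(x in ~` ball x0 r) (expR (eps * enorm (x - x0) `^ alpha))%:E)%E).
  apply: ge0_le_integral => //.
  - by move=> x _; rewrite lee_fin expR_ge0.
  - exact: measurable_funTS.
  - move=> x /(enorm_ge_ball r0) xr.
    rewrite lee_fin ler_expR ler_wpM2l ?(ltW eps_gt0)//.
    rewrite ge0_ler_powR ?nnegrE ?enorm_ge0 ?(ltW r0)//.
    exact: le_trans alpha_ge1.
by apply: ge0_subset_integral => // x _; rewrite lee_fin expR_ge0.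
Qed.

Lemma exists_ball_mass (a : R) : 0 < a ->
  exists2 r, 1 <= r & (mu (~` ball x0 r) <= a%:E)%E.
Proof.
move=> a0; have [M M0 hM] := tail_mass.
pose r := 1 + M / (a * eps).
have r1 : 1 <= r by rewrite lerDl divr_ge0// mulr_ge0// ltW.
have r0 : 0 < r by exact: lt_le_trans r1.
exists r => //; apply: (le_trans (hM r r0)).
rewrite lee_fin ler_pdivrMr ?expR_gt0//.
apply: (@le_trans _ _ (a * (1 + eps * r `^ alpha))); last first.
  by rewrite ler_wpM2l ?(ltW a0)// expR_ge1Dx.
have ra : r <= r `^ alpha by rewrite -[leLHS]powRr1 ?(ltW r0)// ler_powR.
have Mr : M <= a * (eps * r).
  rewrite /r mulrA mulrDr mulr1 mulrCA divff ?mulr1 ?lerDr ?mulr_ge0 ?ltW//.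
  by rewrite mulf_neq0 ?gt_eqF.
apply: (le_trans Mr); rewrite ler_wpM2l ?(ltW a0)//.
by rewrite ler_wpDl// ler_wpM2l// ltW.
Qed.
End exponential_moment.

Section isoperimetric_bounds.
Context (R : realType) (d : nat) (V : 'rV[R]_d -> R).
Variable mu : probability 'rV[R]_d R.
Variables (K eps alpha : R) (x0 : 'rV[R]_d).
Hypothesis Vcont : continuous V.
Hypothesis muE : forall A : set 'rV[R]_d, measurable A ->
  mu A = (\int[lebesgue_row R d]_(x in A) (expR (- V x))%:E)%E.
Hypothesis K0 : 0 <= K.
Hypothesis Vsc : forall x z t, 0 <= t <= 1 ->
  V (slide t z x) <=
    (1 - t) * V x + t * V z + K * (t * (1 - t)) * enorm (z - x) ^+ 2.
Hypotheses (eps_gt0 : 0 < eps) (alpha_gt2 : 2 < alpha).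
Hypothesis mu_exp :
  (\int[mu]_x (expR (eps * enorm (x - x0) `^ alpha))%:E < +oo)%E.

Let alpha1 : 1 <= alpha.
Proof. by rewrite (le_trans _ (ltW alpha_gt2))// ler1n. Qed.

Let unit_ball_bound : exists2 C1, 0 <= C1 & forall x, ball x0 1 x -> V x <= C1.
Proof.
have [C hC] := bounded_above_on_ball x0 Vcont ltr01.
exists (Num.max 0 C) => [|x x1]; first by rewrite le_max lexx.
by rewrite le_max hC// orbT.
Qed.

Lemma mid_set_bound (t0 : R) : 0 < t0 ->
  exists2 c, 0 < c & exists2 h0, 0 < h0 &
    forall (E S : set 'rV[R]_d) h, measurable E -> measurable S ->
    (t0%:E <= mu E)%E -> (t0%:E <= mu (~` E))%E ->
    separates E S h -> 0 < h < h0 -> (c%:E <= h^-1%:E * mu S)%E.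
Proof.
move=> t00; have [C1 C10 hC1] := unit_ball_bound.
have t20 : 0 < t0 / 2 by rewrite divr_gt0.
have [r r1 far] := exists_ball_mass eps_gt0 alpha1 mu_exp t20.
have r0 : 0 < r by exact: lt_le_trans r1.
have [Cr hCr] := bounded_above_on_ball x0 Vcont r0.
pose B := potential_floor V K x0 C1; pose Q := chord_defect d K.
pose C := expR (Cr + B * r ^+ 2 + Q * r ^+ 2).
have C0 : 0 < C by exact: expR_gt0.
have Vlo x : ball x0 r x -> - (B * r ^+ 2) <= V x.
  exact: (potential_ge K0 Vsc C10 hC1 r1).
have Q0 : 0 <= Q * r ^+ 2 by rewrite mulr_ge0 ?sqr_ge0 ?chord_defect_ge0.
have dens x z t : ball x0 r x -> ball x0 r z -> 0 <= t <= 2^-1 ->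
    expR (- V x) <= C * expR (- V (slide t z x)).
  move=> xr zr /andP[t_ge0 t_le]; rewrite -expRD ler_expR.
  have t1 : t <= 1 by lra.
  have t01 : 0 <= t <= 1 by rewrite t_ge0 t1.
  have := slide_potential_le K0 Vsc r0 xr zr t01; rewrite -/Q.
  have P0 : 0 <= Cr + B * r ^+ 2 + Q * r ^+ 2.
    by move: (hCr _ xr) (Vlo _ xr); lra.
  have := ler_wpM2r P0 t1.
  have := ler_wpM2l t_ge0 (hCr _ zr); have := ler_wpM2l t_ge0 (Vlo _ xr); lra.
pose Y := 6 * d.+1%:R * r * C * 2 ^+ d.
have Y0 : 0 < Y.
  by rewrite /Y; repeat apply: mulr_gt0 => //; rewrite exprn_gt0.
exists ((t0 / 2) ^+ 2 / Y); first by rewrite divr_gt0 ?exprn_gt0.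
exists (d.+1%:R * r); first by rewrite mulr_gt0.
move=> E S h mE mS tE tnE sep /andP[h0 hh].
have mb : measurable (ball x0 r) by exact: measurable_ball_row.
have half A : measurable A -> (t0%:E <= mu A)%E ->
    ((t0 / 2)%:E <= mu (A `&` ball x0 r))%E.
  move=> mA tA; have : (mu A <= mu (A `&` ball x0 r) + (t0 / 2)%:E)%E.
    have mAb : measurable (A `&` ball x0 r) by exact: measurableI.
    have mnb : measurable (~` ball x0 r) by exact: measurableC.
    apply: (@le_trans _ _ (mu (A `&` ball x0 r `|` ~` ball x0 r))).
      rewrite le_measure ?inE//; first exact: measurableU.
      by move=> x Ax; have [xr|nxr] := pselect (ball x0 r x); [left|right].
    by apply: (le_trans (measureU2 _ _ _)) => //; rewrite leeD2l.
  move=> /(le_trans tA); rewrite -leeBlDr// -EFinB => /(le_trans _); apply.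
  by rewrite lee_fin; lra.
have hhr : 0 < h <= d.+1%:R * r by rewrite h0 ltW.
have := midpoint_flux Vcont muE mE mS sep r0 (ltW C0) hhr (ltW t20) dens
  (half _ mE tE) (half _ (measurableC mE) tnE).
rewrite -/Y => hm.
rewrite mulrC EFinM lee_pdivrMl//; apply: (le_trans hm).
by rewrite EFinM muleA.
Qed.

(** [tail_flux] with [s] of order [1 / L] and [r] of order [L ^ (1 / alpha)],
    beyond which at most a quarter of [e ^ (- L)] is left. The
    errors due to semiconvexity are of order [s * r ^ 2], that is
    [L ^ (2 / alpha - 1)], which tends to 0 because [alpha > 2]. The rate [1 / (s * r)] given by [crossing_rate] is of order
    [L ^ (1 - 1 / alpha)]. *)
Lemma small_set_bound :
  exists2 c, 0 < c & exists L0, forall (E : set 'rV[R]_d) L,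
    measurable E -> L0 <= L -> mu E = (expR (- L))%:E ->
    exists2 h0, 0 < h0 & forall (S : set 'rV[R]_d) h, measurable S ->
      separates E S h -> 0 < h < h0 ->
      ((c * expR (- L) * L `^ (1 - 1 / alpha))%:E <= h^-1%:E * mu S)%E.
Proof.
have [C1 C10 hC1] := unit_ball_bound.
have [M M0 hM] := tail_mass eps_gt0 alpha1 mu_exp.
have alpha0 : 0 < alpha by exact: lt_le_trans alpha1.
have p_lt : 2 * (1 / alpha) < 1 by rewrite mulrA mulr1 ltr_pdivrMr// mul1r.
have p_gt0 : 0 < 1 / alpha by rewrite divr_gt0.
have pa : 1 / alpha * alpha = 1 by rewrite divfK// gt_eqF.
set p := 1 / alpha in p_lt p_gt0 pa *.
pose lam : R := 2 * (3 + d%:R).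
have lam0 : 0 < lam by rewrite mulr_gt0// ltr_wpDr.
pose P := potential_floor V K x0 C1 + C1 + chord_defect d K.
have P0 : 0 <= P.
  by rewrite addr_ge0 ?chord_defect_ge0// addr_ge0// potential_floor_ge0.
pose a := (2 / eps) `^ p.
have a0 : 0 < a by apply: powR_gt0; exact: divr_gt0.
pose q := lam * P * (a ^+ 2).
have q0 : 0 <= q by rewrite mulr_ge0 ?sqr_ge0// mulr_ge0// ltW.
pose e : R := expR 1.
have e0 : 0 < e by exact: expR_gt0.
pose Y := 6 * d.+1%:R * e * 2 ^+ d.
have Y0 : 0 < Y by rewrite mulr_gt0 ?exprn_gt0// mulr_gt0// mulr_gt0.
exists (4 * Y * lam * a)^-1.
  by rewrite invr_gt0 mulr_gt0// mulr_gt0// mulr_gt0.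
(* the summands serve in turn s <= 1 / 2, r >= 1, the mass outside the ball,
   the volume of the low part of E, the bound on s * r ^ 2, and L >= 1 *)
exists (2 * lam + eps + 4 * M + 16 * e * d.+1%:R + q `^ (1 - 2 * p)^-1 + 1).
move=> E L mE hL muEL.
have u1 : 0 <= 16 * e * d.+1%:R by rewrite mulr_ge0// mulr_ge0// ltW.
have u2 : 0 <= q `^ (1 - 2 * p)^-1 by exact: powR_ge0.
have u3 := ltW eps_gt0.
have [L1 L2 L3 L4] : [/\ 2 * lam <= L, eps <= L, 4 * M <= L &
    16 * e * d.+1%:R <= L].
  move: hL u1 u2 u3 (ltW lam0) M0; move: (_ * e * _) (q `^ _) => u v.
  by move=> *; split; lra.
have [L5 L6] : q `^ (1 - 2 * p)^-1 <= L /\ 1 <= L.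
  move: hL u1 u2 u3 (ltW lam0) M0; move: (_ * e * _) (q `^ _) => u v.
  by move=> *; split; lra.
have L0 : 0 < L by exact: lt_le_trans L6.
pose s := lam / L; pose r := (2 * L / eps) `^ p; pose w := L `^ p.
have s0 : 0 < s by exact: divr_gt0.
have w0 : 0 < w by exact: powR_gt0.
have sL : s * L = lam by rewrite divfK// gt_eqF.
have s2 : s <= 2^-1 by rewrite ler_pdivrMr//; lra.
have b0 : 0 <= 2 * L / eps by rewrite divr_ge0 ?mulr_ge0 ?(ltW L0) ?(ltW eps_gt0).
have rE : r = a * w.
  rewrite /r /a /w -powRM ?(ltW L0) ?divr_ge0 ?(ltW eps_gt0)//.
  by rewrite mulrAC.
have r1 : 1 <= r.
  apply: (@le_trans _ _ (1 `^ p)); first by rewrite powR1.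
  rewrite ge0_ler_powR ?nnegrE ?(ltW p_gt0)//.
  by rewrite ler_pdivlMr// mul1r; lra.
have r0 : 0 < r by exact: lt_le_trans r1.
have far : (mu (~` ball x0 r) <= (expR (- L) / 4)%:E)%E.
  apply: (le_trans (hM r r0)); rewrite lee_fin /r -powRrM pa powRr1//.
  rewrite [eps * _]mulrC divfK ?gt_eqF// mulr_natl mulr2n expRD expRN.
  rewrite ler_pdivrMr ?mulr_gt0 ?expR_gt0//.
  have EL : 4 * M <= expR L.
    by apply: (le_trans L3); apply: (le_trans _ (expR_ge1Dx L)); rewrite lerDr.
  rewrite (_ : _ * (_ * _) = expR L / 4); last by field; rewrite gt_eqF ?expR_gt0.
  by move: EL; lra.
have small : s * (P * r ^+ 2) <= 1.
  have qL : q <= L `^ (1 - 2 * p).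
    have pp : 0 < 1 - 2 * p by rewrite subr_gt0.
    apply: (@le_trans _ _ ((q `^ (1 - 2 * p)^-1) `^ (1 - 2 * p))).
      by rewrite -powRrM mulVf ?gt_eqF// powRr1.
    by rewrite ge0_ler_powR ?nnegrE ?(ltW pp) ?(ltW L0).
  have LE : L = w ^+ 2 * L `^ (1 - 2 * p).
    rewrite /w -powR_mulrn ?powR_ge0// -powRrM -powRD; last first.
      by rewrite (gt_eqF L0) implybT.
    by rewrite mulrC addrC subrK powRr1// ltW.
  rewrite (_ : s * _ = q * w ^+ 2 / L); last by rewrite /s /q rE; field; rewrite gt_eqF.
  by rewrite ler_pdivrMr// mul1r [leRHS]LE mulrC ler_wpM2l// sqr_ge0.
(* with y = L / (2 * d.+1), y ^ d.+1 <= e ^ (L / 2) and 1 / s <= y *)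
have vol : s ^- d * expR (1 - L / 2) <= 8^-1.
  pose y := L / (2 * d.+1%:R).
  have D0 : 0 < 2 * d.+1%:R :> R by rewrite mulr_gt0.
  have y8 : 8 * e <= y by rewrite ler_pdivlMr//; move: L4; lra.
  have y0 : 0 <= y by rewrite divr_ge0 ?(ltW L0) ?(ltW D0).
  have sy : s ^- d <= y ^+ d.
    rewrite -exprVn lerXn2r ?nnegrE ?invr_ge0 ?(ltW s0)//.
    rewrite /s invf_div ler_wpM2l ?(ltW L0)// lef_pV2 ?posrE//.
    by rewrite /lam ler_wpM2l// -addn1 natrD; lra.
  have ey : y ^+ d.+1 <= expR (L / 2).
    rewrite (_ : L / 2 = d.+1%:R * y); last first.
      by rewrite /y invfM mulrCA [_ * (2^-1 * _)]mulrCA divff ?pnatr_eq0// mulr1.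
    rewrite expRM_natl lerXn2r ?nnegrE ?expR_ge0//.
    by apply: (le_trans _ (expR_ge1Dx y)); rewrite lerDr.
  have eL := expR_gt0 (L / 2).
  rewrite expRD expRN -/e mulrA ler_pdivrMr// ler_pdivlMl//.
  apply: (le_trans _ ey); rewrite exprS.
  have := ler_wpM2r (exprn_ge0 d y0) y8.
  have := ler_wpM2r (ltW e0) sy; lra.
have [|z z1 flux] :=
  tail_flux Vcont muE K0 Vsc C10 hC1 mE muEL r1 _ sL far small vol.
  by rewrite s0.
have zr : ball x0 r z by exact: le_ball z1.
have s1 : s <= 1 by lra.
exists (s * (d.+1%:R * (2 * r))); first by rewrite mulr_gt0// mulr_gt0// mulr_gt0.
move=> S h mS sep /andP[h0 hh].
have s02 : 0 <= s <= 2^-1 by rewrite (ltW s0).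
have hr : 0 < h <= s * (d.+1%:R * (2 * r)) by rewrite h0 ltW.
have := crossing_rate Vcont muE mE mS sep r0 zr s02 (ltW e0) hr
  (fun x t xr ts => slide_density_ge K0 Vsc C10 hC1 r1 ts s1 xr z1 small).
move=> /(le_trans flux).
have [m ->] : exists m : R, mu S = m%:E.
  by exists (fine (mu S)); rewrite fineK// fin_num_measure.
rewrite -!EFinM !lee_fin => hm.
pose k := Y * lam * a * w / L.
have k0 : 0 < k by rewrite divr_gt0// mulr_gt0// mulr_gt0// mulr_gt0.
have -> : L `^ (1 - p) = L / w.
  by rewrite powRB ?powRr1 ?(ltW L0)// (gt_eqF L0) implybT.
rewrite (_ : _ * (L / w) = (expR (- L) / 4) / k); last first.
  by rewrite /k; field; rewrite !gt_eqF.
rewrite ler_pdivrMr//; apply: (le_trans hm).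
rewrite le_eqVlt; apply/orP; left; apply/eqP; rewrite /k /Y rE /s; field.
by rewrite !gt_eqF.
Qed.

End isoperimetric_bounds.

(** * The isoperimetric inequality *)

Theorem corollary5p14 (R : realType) (d : nat) (V : 'rV[R]_d -> R)
    (mu : probability 'rV[R]_d R) (K eps alpha : R) (x0 : 'rV[R]_d)
    (Vdiff : twice_differentiable V)
    (muE : forall A : set 'rV[R]_d, measurable A ->
      mu A = (\int[lebesgue_row R d]_(x in A) (expR (- V x))%:E)%E)
    (K_ge0 : 0 <= K) (eps_gt0 : 0 < eps) (alpha_gt2 : 2 < alpha)
    (hessV : forall x : 'rV[R]_d, loewner_le (- K *: 1%:M) (hessian V x))
    (mu_exp : (\int[mu]_x (expR (eps * enorm (x - x0) `^ alpha))%:E < +oo)%E) :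
  exists2 kappa : R, 0 < kappa & forall t : R, 0 < t < 1 ->
    ((kappa * Num.min t (1 - t) *
        ln (1 / Num.min t (1 - t)) `^ (1 - 1 / alpha))%:E
      <= isoperimetric_profile mu t)%E.
Proof.
have Vcont : continuous V.
  by move=> x; apply: differentiable_continuous; case: Vdiff.
have K2 : 0 <= K / 2 by rewrite divr_ge0.
have Vsc x z t : 0 <= t <= 1 -> V (slide t z x) <=
    (1 - t) * V x + t * V z + K / 2 * (t * (1 - t)) * enorm (z - x) ^+ 2.
  exact: semiconvex.
have [c1 c1_gt0 [L0 small]] :=
  small_set_bound Vcont muE K2 Vsc eps_gt0 alpha_gt2 mu_exp.
(* e ^ (- L1) separates small sets from sets of intermediate measure *)
pose L1 := Num.max 1 L0; pose q := 1 - 1 / alpha.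
have L1_ge1 : 1 <= L1 by rewrite le_max lexx.
have L1_gt0 : 0 < L1 by exact: lt_le_trans L1_ge1.
have q_ge0 : 0 <= q.
  have a0 : 0 < alpha by exact: lt_trans alpha_gt2.
  by rewrite subr_ge0 ler_pdivrMr// mul1r (le_trans _ (ltW alpha_gt2))// ler1n.
have t0_gt0 : 0 < expR (- L1) by exact: expR_gt0.
have [c2 c2_gt0 [h2 h2_gt0 mid]] :=
  mid_set_bound Vcont muE K2 Vsc eps_gt0 alpha_gt2 mu_exp t0_gt0.
have w_gt0 : 0 < L1 `^ q by exact: powR_gt0.
exists (Num.min c1 (c2 / L1 `^ q)).
  by rewrite lt_min c1_gt0 divr_gt0.
set kappa := Num.min _ _.
move=> t /andP[t_gt0 t_lt1]; set m := Num.min t (1 - t).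
have m_gt0 : 0 < m by rewrite lt_min t_gt0 subr_gt0.
have m_le1 : m <= 1 by rewrite ge_min (ltW t_lt1).
have kappa_ge0 : 0 <= kappa.
  by rewrite le_min (ltW c1_gt0) divr_ge0 ?(ltW c2_gt0) ?(ltW w_gt0).
pose L := ln (1 / m).
have mL : expR (- L) = m.
  by rewrite /L div1r lnV ?posrE// opprK lnK ?posrE.
have L_ge0 : 0 <= L by rewrite /L ln_ge0// div1r invf_ge1.
apply: le_ereal_inf_tmp => _ [A [mA muA] <-].
have muAC : mu (~` A) = (1 - t)%:E by rewrite probability_setC// muA EFinB.
have mAC : measurable (~` A) by exact: measurableC.
have [L_large|L_small] := leP L1 L.
- have hL : L0 <= L by apply: le_trans L_large; rewrite le_max lexx orbT.
  have [E mE [muEL sepE]] : exists2 E : set 'rV[R]_d, measurable E &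
      mu E = (expR (- L))%:E /\
      forall h, separates E (outer_layer A h) h.
    have [mt|mt] := leP t (1 - t).
      exists A => //; split => [|h]; last exact: separates_outer_layer.
      by rewrite muA mL /m min_l.
    exists (~` A) => //; split => [|h].
      by rewrite muAC mL /m min_r// ltW.
    exact/separatesC/separates_outer_layer.
  have [h0 h0_gt0 bound] := small E L mE hL muEL.
  apply: (boundary_measure_ge h0_gt0) => h hh.
  apply: (le_trans _ (bound _ h (measurable_outer_layer h mA) (sepE h) hh)).
  rewrite lee_fin mL -/L -/q ler_wpM2r ?powR_ge0// ler_wpM2r ?(ltW m_gt0)//.
  by rewrite /kappa ge_min lexx.
- have m_ge : expR (- L1) <= m by rewrite -mL ler_expR lerN2 ltW.
  have [tm tm'] : expR (- L1) <= t /\ expR (- L1) <= 1 - t.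
    by split; rewrite (le_trans m_ge)// /m ge_min lexx// orbT.
  apply: (boundary_measure_ge h2_gt0) => h hh.
  apply: (le_trans _ (mid A (outer_layer A h) h mA
    (measurable_outer_layer h mA) _ _ (@separates_outer_layer _ _ A h) hh));
    rewrite ?muA ?muAC ?lee_fin//.
  apply: (@le_trans _ _ (c2 / L1 `^ q * 1 * L1 `^ q)); last first.
    by rewrite mulr1 divfK// gt_eqF.
  apply: ler_pM; rewrite ?powR_ge0//.
  + by rewrite mulr_ge0// ltW.
  + by apply: ler_pM => //; [exact: ltW|rewrite /kappa ge_min lexx orbT].
  + by rewrite ge0_ler_powR ?nnegrE ?(ltW L1_gt0)// ltW.
Qed.
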